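(* Let $\Lambda$ be a canonical algebra with three arms over an algebraically closed field $k$. Then each indecomposable $\Lambda$-module $M$ of rank two can be described by matrices having coefficients $0,1,-1$; that is, one can choose bases of the vector spaces $M_v$ ($v$ a vertex of the quiver of $\Lambda$) such that for every arrow $\alpha$ the matrix of $M_\alpha$ has all entries in $\{0,1,-1\}$.
   Context: Canonical algebras: let $t\ge 3$, let $\underline p=(p_1,\dots,p_t)$ be integers $p_i\ge 2$ (weights) and $\lambda_3,\dots,\lambda_t\in k$ pairwise distinct nonzero parameters, normalized so that $\lambda_3=1$. The canonical algebra $\Lambda=\Lambda(\underline p,\underline\lambda)$ with $t$ arms is the path algebra of the quiver with vertices $0$, $m\vec x_i$ ($1\le i\le t$, $1\le m\le p_i-1$) and $\vec c$, and arrows $\alpha^{(i)}_m:(m-1)\vec x_i\to m\vec x_i$ for $1\le i\le t$, $1\le m\le p_i$ (with $0\vec x_i=0$ and $p_i\vec x_i=\vec c$), modulo the canonical relations $\alpha^{(i)}_{p_i}\cdots\alpha^{(i)}_1=\alpha^{(1)}_{p_1}\cdots\alpha^{(1)}_1+\lambda_i\,\alpha^{(2)}_{p_2}\cdots\alpha^{(2)}_1$ for $i=3,\dots,t$. Here $t=3$. Modules are finitely generated right modules: such a module $M$ consists of finite-dimensional vector spaces $M_v$ for every vertex $v$ and linear maps $M_\alpha:M_w\to M_v$ for every arrow $\alpha:v\to w$, satisfying the canonical relations. The rank of $M$ is $\mathrm{rk}\,M=\dim_k M_0-\dim_k M_{\vec c}$. *)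

(* Defs.v *)
From HB Require Import structures.
From mathcomp Require Import all_boot all_order all_algebra.

Set Implicit Arguments.
Unset Strict Implicit.
Unset Printing Implicit Defensive.

Import Order.TTheory GRing.Theory Num.Theory.
Local Open Scope ring_scope.

(* Arms are numbered from 0, so arm i : 'I_t is the (i+1)-st arm.  Only the
   parameters of the arms i >= 2 are meaningful; the values [param i] for
   i < 2 are never used. *)
Record canonical_data (k : fieldType) (t : nat) := CanonicalData {
  weight : 'I_t -> nat;
  param : 'I_t -> k;
  arms_ge3 : (3 <= t)%N;
  weight_ge2 : forall i, (2 <= weight i)%N;
  param_neq0 : forall i : 'I_t, (2 <= i)%N -> param i != 0;
  param_inj : forall i j : 'I_t, (2 <= i)%N -> (2 <= j)%N ->
    param i = param j -> i = j;
  param_normalized : forall i : 'I_t, i = 2%N :> nat -> param i = 1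
}.

Section Quiver.

Variables (k : fieldType) (t : nat) (L : canonical_data k t).

(* [vmid i j] is the vertex (j+1) x_i, with 1 <= j+1 <= p_i - 1. *)
Inductive vertex : Type :=
| vzero : vertex
| vmid (i : 'I_t) (j : 'I_(weight L i).-1) : vertex
| vc : vertex.

(* The arrows of arm i: the first one 0 -> x_i, the intermediate ones
   m x_i -> (m+1) x_i, and the last one (p_i - 1) x_i -> c. *)
Inductive arrow : vertex -> vertex -> Type :=
| afirst (i : 'I_t) (j : 'I_(weight L i).-1) of j = 0%N :> nat :
    arrow vzero (vmid j)
| amid (i : 'I_t) (j j' : 'I_(weight L i).-1) of j' = j.+1 :> nat :
    arrow (vmid j) (vmid j')
| alast (i : 'I_t) (j : 'I_(weight L i).-1) of j.+2 = weight L i :> nat :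
    arrow (vmid j) vc.

Lemma last_inner_lt (i : 'I_t) : ((weight L i).-2 < (weight L i).-1)%N.
Proof. by case: (weight L i) (weight_ge2 L i) => [|[|n]]. Qed.

Lemma last_innerE (i : 'I_t) : (weight L i).-2.+2 = weight L i.
Proof. by case: (weight L i) (weight_ge2 L i) => [|[|n]]. Qed.

Section Composites.

Variables (X : vertex -> vectType k).
Variable f : forall v w, arrow v w -> 'Hom(X w, X v).

(* The composite X_((m+1) x_i) -> ... -> X_(x_i) -> X_0. *)
Fixpoint inner_map (i : 'I_t) (m : nat) :
    forall h : (m < (weight L i).-1)%N, 'Hom(X (vmid (Ordinal h)), X vzero) :=
  match m with
  | 0%N => fun h => f (@afirst i (Ordinal h) erefl)
  | m'.+1 => fun h =>
      (inner_map (ltnW h) \o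
         f (@amid i (Ordinal (ltnW h)) (Ordinal h) erefl))%VF
  end.

(* The map X_c -> X_0 induced by the full path of arm i. *)
Definition arm_map (i : 'I_t) : 'Hom(X vc, X vzero) :=
  (inner_map (last_inner_lt i) \o
     f (@alast i (Ordinal (last_inner_lt i)) (last_innerE i)))%VF.

Definition canonical_relations : Prop :=
  forall i1 i2 i : 'I_t, i1 = 0%N :> nat -> i2 = 1%N :> nat -> (2 <= i)%N ->
    arm_map i = arm_map i1 + param L i *: arm_map i2.

End Composites.

(* Right modules: an arrow v -> w acts as a linear map M_w -> M_v. *)
Record canonical_module := CanonicalModule {
  space :> vertex -> vectType k;
  action : forall v w, arrow v w -> 'Hom(space w, space v);
  action_relations : canonical_relations action
}.

Definition rank (M : canonical_module) : int :=
  (\dim {:M vzero})%:Z - (\dim {:M vc})%:Z.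

Definition submodule (M : canonical_module)
    (U : forall v, {vspace M v}) : Prop :=
  forall v w (a : arrow v w), (action M a @: U w <= U v)%VS.

Definition indecomposable (M : canonical_module) : Prop :=
  (exists v, {:M v}%VS != 0%VS) /\
  forall U W : forall v, {vspace M v},
    submodule U -> submodule W ->
    (forall v, (U v + W v = fullv)%VS /\ (U v :&: W v = 0)%VS) ->
    (forall v, U v = 0%VS) \/ (forall v, W v = 0%VS).

(* [passmx.mxof] acts on row vectors, so it is the transpose of the matrix
   acting on column vectors; this does not affect the set of entries. *)
Definition described_by_01m1 (M : canonical_module) : Prop :=
  exists b : forall v, (\dim {:M v}).-tuple (M v),
    (forall v, basis_of {:M v} (b v)) /\
    forall v w (a : arrow v w) i j,
      passmx.mxof (b w) (b v) (action M a) i j \in [:: 0; 1; -1].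

End Quiver.

(* Main.v *)
(** Write [W = M_c], [V = M_0] and [f_1], [f_2], [f_3 = f_1 + f_2 : W -> V] for
    the three arm maps.  Choose [X <= W] minimizing
    [dim (f_1 X + f_2 X) - dim X], and of maximal dimension among the
    minimizers.  [X] generates the torsion submodule of [M]; it splits off
    because the obstruction is, by trace duality, a degree one morphism of
    pencils from the torsion part to the torsion-free part, and such a morphism
    vanishes.  So an indecomposable [M] of positive rank is torsion-free: the
    pencil [(f_1, f_2)] is free and all the maps to [V] are injective.

    For rank two, the pencil is then a sum of two chains [x_0, ..., x_a] and
    [y_0, ..., y_b] (that is, O(a) + O(b) on the projective line), and each arm
    amounts to at most one line in the two-dimensional space [V / f_i W], which
    is the fibre at one of three points.  The automorphisms of the pair of
    chains bring these three lines to lines spanned by vectors with coordinates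
    0 and 1.  This last part does not use indecomposability. *)
Require Import Defs.
From HB Require Import structures.
From mathcomp Require Import all_boot all_order all_algebra.
From mathcomp Require Import zify ring.
From Stdlib Require Import Classical.

Set Implicit Arguments.
Unset Strict Implicit.
Unset Printing Implicit Defensive.

Import GRing.Theory Num.Theory.
Local Open Scope ring_scope.

(** * Extensions of pencils split by trace duality *)

Section TraceDuality.

Variable k : fieldType.

Lemma mxtrace_dual m n (l : 'M[k]_(m, n) -> k) :
  scalar l -> exists d : 'M_(n, m), forall y, l y = \tr (d *m y).
Proof.
move=> lin_l.
pose lM := GRing.isLinear.Build k 'M[k]_(m, n) k *%R l lin_l.
pose L : {scalar 'M[k]_(m, n)} := HB.pack l lM.
exists (\matrix_(j, i) l (delta_mx i j)) => y.
rewrite -[l y]/(L y) {1}(matrix_sum_delta y) linear_sum /mxtrace.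
under eq_bigr do rewrite linear_sum.
rewrite exchange_big; apply: eq_bigr => j _; rewrite mxE.
by apply: eq_bigr => i _; rewrite linearZ mxE mulrC.
Qed.

Lemma mxtrace_eq0 m n (d : 'M[k]_(n, m)) :
  (forall y : 'M_(m, n), \tr (d *m y) = 0) -> d = 0.
Proof.
move=> d0; apply/matrixP=> i j; rewrite mxE -(d0 (delta_mx j i)) /mxtrace.
rewrite (bigD1 i) //= mxE (bigD1 j) //= mxE !eqxx mulr1 !big1 ?addr0 //.
  move=> i' ne; rewrite mxE big1 // => j' _.
  by rewrite mxE (negPf ne) andbF mulr0.
by move=> j' ne; rewrite mxE (negPf ne) mulr0.
Qed.

(** The form is a coordinate of the projection onto a complement of the image that does not vanish
    at [y]. *)
Lemma limg_separation (U V : vectType k) (f : 'Hom(U, V)) y :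
  y \notin limg f ->
  exists l : V -> k, [/\ scalar l, forall u, l (f u) = 0 & l y != 0].
Proof.
move=> y_notin; pose L := limg f; pose p := daddv_pi L^C L.
have LC : (L^C :&: L = 0)%VS by rewrite capvC capv_compl.
have pqE w : p w + daddv_pi L L^C w = w.
  by rewrite daddv_pi_add // addvC addv_complf memvf.
have pL w : w \in L -> p w = 0.
  move=> wL; apply: (@addIr _ w); rewrite add0r -[RHS]pqE.
  by rewrite [daddv_pi L _ w]daddv_pi_id ?capv_compl.
have py0 : p y != 0.
  apply: contra y_notin => /eqP py0.
  by rewrite -(pqE y) py0 add0r memv_pi.
have [i li] : exists i, coord (vbasis L^C) i (p y) != 0.
  apply/existsP; apply: contraR py0 => /existsPn H.
  rewrite (coord_vbasis (memv_pi L^C L y)) big1 // => i _.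
  by move: (H i); rewrite negbK => /eqP ->; rewrite scale0r.
exists (fun w => coord (vbasis L^C) i (p w)); split=> //.
  by move=> a u v; rewrite !linearP.
by move=> u; rewrite pL ?linear0 // memv_img ?memvf.
Qed.

End TraceDuality.

Section PencilExtensions.

Variables (k : fieldType) (nc n0 mc m0 : nat).
Variables (f1 f2 : 'M[k]_(nc, n0)) (t1 t2 : 'M[k]_(mc, m0)).

Hypothesis f_free : forall p (Z : 'M_(p, nc)),
  Z != 0 -> (\rank Z < \rank (Z *m f1 + Z *m f2)%MS)%N.
Hypothesis t_torsion : forall p (A : 'M_(p, mc)),
  (m0 + \rank A <= mc + \rank (A *m t1 + A *m t2)%MS)%N.

(* The hypotheses say that [v |-> (v e1, v e2)] modulo [(u f1, u f2)] is a
   morphism from the torsion pencil to the twist by O(1) of the free one. *)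
Lemma pencil_hom_eq0 (d1 d2 : 'M_(mc, nc)) (e1 e2 : 'M_(m0, n0)) :
    d1 *m f1 + t1 *m e1 = 0 -> d2 *m f2 + t2 *m e2 = 0 ->
    d1 *m f2 + d2 *m f1 + t1 *m e2 + t2 *m e1 = 0 ->
  (row_mx e1 e2 <= row_mx f1 f2)%MS.
Proof.
move=> E1 E2 E3.
set E := row_mx e1 e2; set G := row_mx f1 f2.
pose xi := t1 *m e2 + d1 *m f2; pose Q := cokermx G.
have GQ : G *m Q = 0 by rewrite mulmx_coker.
have {}E1 : t1 *m e1 = - (d1 *m f1).
  by apply/eqP; rewrite -addr_eq0 addrC E1.
have {}E2 : t2 *m e2 = - (d2 *m f2).
  by apply/eqP; rewrite -addr_eq0 addrC E2.
have {}E3 : t2 *m e1 = - xi - d2 *m f1.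
  apply/eqP; rewrite -opprD -addr_eq0 -E3; apply/eqP.
  by rewrite addrC /xi -[_ + _ *m f2 + _]addrA [X in X + _]addrC.
have t1E : t1 *m E = row_mx 0 xi - d1 *m G.
  by rewrite !mul_mx_row opp_row_mx add_row_mx E1 add0r /xi addrK.
have t2E : t2 *m E = - row_mx xi 0 - d2 *m G.
  by rewrite !mul_mx_row !opp_row_mx add_row_mx E2 E3 oppr0 add0r.
pose K := kermx xi; pose B := kermx (E *m Q).
have KB : (K *m t1 + K *m t2 <= B)%MS.
  rewrite addsmx_sub; apply/andP; split; apply/sub_kermxP.
    rewrite mulmxA -(mulmxA K) t1E mulmxBr mul_mx_row mulmx0 mulmx_ker.
    by rewrite row_mx0 sub0r mulNmx -!mulmxA GQ !mulmx0 oppr0.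
  rewrite mulmxA -(mulmxA K) t2E mulmxBr mulmxN mul_mx_row mulmx0 mulmx_ker.
  by rewrite row_mx0 oppr0 sub0r mulNmx -!mulmxA GQ !mulmx0 oppr0.
(* The torsion inequality for the kernel of [xi]: the image of the morphism has a target no larger
   than its source. *)
have rEQ : (\rank (E *m Q) <= \rank xi)%N.
  have := leq_trans (t_torsion K) (leq_add (leqnn _) (mxrankS KB)).
  rewrite !mxrank_ker.
  by have := rank_leq_row (E *m Q); have := rank_leq_row xi; lia.
(* [P2] consists of two copies of the image of [xi], so [P2 *m Q] is what this image generates in
   the twist. It lies in the image of [E *m Q], so at least rank [xi] dimensions of [P2] are lost in
   [G]. They come from rows [Z] with both [Z *m f1] and [Z *m f2] inside [xi], and freeness leaves
   room for fewer than rank [xi] of these unless [xi] vanishes. *)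
pose P2 := col_mx (row_mx xi 0) (row_mx 0 xi).
have P2Q : (P2 *m Q <= E *m Q)%MS.
  rewrite mul_col_mx -addsmxE addsmx_sub; apply/andP; split.
    suff -> : row_mx xi 0 *m Q = - t2 *m (E *m Q) by rewrite submxMl.
    by rewrite mulmxA mulNmx t2E opprB opprK mulmxDl -mulmxA GQ mulmx0 add0r.
  suff -> : row_mx 0 xi *m Q = t1 *m (E *m Q) by rewrite submxMl.
  by rewrite mulmxA t1E mulmxBl -mulmxA GQ mulmx0 subr0.
have rP2 : \rank P2 = (\rank xi + \rank xi)%N.
  by rewrite -/(block_mx xi 0 0 xi) rank_diag_block_mx.
pose I := (P2 :&: G)%MS; pose Z := I *m pinvmx G.
have ZG : Z *m G = I by rewrite mulmxKpV ?capmxSr.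
have Zxi : (Z *m f1 + Z *m f2 <= xi)%MS.
  have /submxP [D DE] : (Z *m G <= P2)%MS by rewrite ZG capmxSl.
  move: DE; rewrite mul_mx_row -[D]hsubmxK mul_row_col !mul_mx_row !mulmx0.
  rewrite add_row_mx addr0 add0r => /eq_row_mx [-> ->].
  by rewrite addsmx_sub !submxMl.
have rI : (\rank I <= \rank Z)%N by rewrite -ZG mxrankM_maxl.
have rP2Q := mxrank_mul_ker P2 Q.
have rcap : (\rank (P2 :&: kermx Q)%MS <= \rank I)%N.
  by rewrite mxrankS // capmxS // submxE mulmx_ker.
have xi0 : \rank xi = 0%N.
  apply/eqP; rewrite -leqn0 leqNgt; apply/negP => xi_gt0.
  have : (\rank I < \rank xi)%N.
    have [Z0|nzZ] := eqVneq Z 0; first by rewrite (leq_ltn_trans rI) // Z0 mxrank0.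
    exact: leq_ltn_trans rI (leq_trans (f_free nzZ) (mxrankS Zxi)).
  by have := mxrankS P2Q; lia.
rewrite submxE -mxrank_eq0 -leqn0 -/Q; lia.
Qed.

(* [d1], [d2], [e1], [e2] represent, through the trace form, a functional that
   vanishes on all solvable right-hand sides. *)
Lemma pencil_ext_split (g1 g2 : 'M_(n0, m0)) :
    f1 *m g1 + f2 *m g2 = 0 ->
  exists s1 s2 s3 : 'M_(n0, mc),
    [/\ f1 *m s1 = (f1 + f2) *m s3, f2 *m s2 = (f1 + f2) *m s3,
        s1 *m t1 = g1 + s3 *m (t1 + t2) & s2 *m t2 = g2 + s3 *m (t1 + t2)].
Proof.
move=> fg0.
move f3E : (f1 + f2) => f3; move t3E : (t1 + t2) => t3.
pose aT := ('M[k]_(n0, mc) * 'M[k]_(n0, mc) * 'M[k]_(n0, mc))%type.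
pose rT := (('M[k]_(nc, mc) * 'M[k]_(nc, mc)) *
            ('M[k]_(n0, m0) * 'M[k]_(n0, m0)))%type.
(* The four equations form an inhomogeneous linear system with right-hand side [y] below; if [y]
   were outside the image of [phi], a form [l] would separate it. *)
pose phi (s : aT) : rT :=
  ((f1 *m s.1.1 - f3 *m s.2, f2 *m s.1.2 - f3 *m s.2),
   (s.1.1 *m t1 - s.2 *m t3, s.1.2 *m t2 - s.2 *m t3)).
have phi_lin : linear phi.
  move=> a [[u1 u2] u3] [[v1 v2] v3]; rewrite /phi /=.
  have sub_lin (U : lmodType k) (x y z w : U) :
    a *: x + y - (a *: z + w) = a *: (x - z) + (y - w).
    by rewrite opprD addrACA scalerBr.
  by rewrite !mulmxDr !mulmxDl -!scalemxAr -!scalemxAl !sub_lin.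
pose phiM := GRing.isLinear.Build k aT rT *:%R phi phi_lin.
pose Phi : {linear aT -> rT} := HB.pack phi phiM.
pose y : rT := ((0, 0), (g1, g2)).
have [/memv_imgP [[[s1 s2] s3] _] | ] := boolP (y \in limg (linfun Phi)).
  rewrite lfunE => -[] /esym/eqP; rewrite subr_eq0 => /eqP E1.
  move=> /esym/eqP; rewrite subr_eq0 => /eqP E2 -> ->.
  by exists s1, s2, s3; rewrite E1 E2 !subrK.
case/limg_separation => l [l_lin l_phi /eqP[]].
have lphi0 s1 s2 s3 : l (phi (s1, s2, s3)) = 0 by rewrite -[RHS](l_phi (s1, s2, s3)) lfunE.
have lD u v : l (u + v) = l u + l v by rewrite -[u]scale1r l_lin mul1r scale1r.
have [d1 d1E] : exists d1, forall u, l ((u, 0), (0, 0)) = \tr (d1 *m u).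
  apply: mxtrace_dual => a u v; rewrite -l_lin; congr (l _).
  by do 2!apply: injective_projections => /=; rewrite ?scaler0 ?addr0.
have [d2 d2E] : exists d2, forall u, l ((0, u), (0, 0)) = \tr (d2 *m u).
  apply: mxtrace_dual => a u v; rewrite -l_lin; congr (l _).
  by do 2!apply: injective_projections => /=; rewrite ?scaler0 ?addr0.
have [e1 e1E] : exists e1, forall u, l ((0, 0), (u, 0)) = \tr (e1 *m u).
  apply: mxtrace_dual => a u v; rewrite -l_lin; congr (l _).
  by do 2!apply: injective_projections => /=; rewrite ?scaler0 ?addr0.
have [e2 e2E] : exists e2, forall u, l ((0, 0), (0, u)) = \tr (e2 *m u).
  apply: mxtrace_dual => a u v; rewrite -l_lin; congr (l _).
  by do 2!apply: injective_projections => /=; rewrite ?scaler0 ?addr0.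
have lE u1 u2 v1 v2 : l ((u1, u2), (v1, v2)) =
    \tr (d1 *m u1) + \tr (d2 *m u2) + \tr (e1 *m v1) + \tr (e2 *m v2).
  rewrite -d1E -d2E -e1E -e2E -!lD; congr (l _).
  by do 2!apply: injective_projections => /=; rewrite !addr0 ?add0r.
(* Testing [l] on each of the three unknowns separately turns its vanishing on the image of [phi]
   into one matrix equation per unknown. *)
have E1 : d1 *m f1 + t1 *m e1 = 0.
  apply: mxtrace_eq0 => s; have := lphi0 s 0 0.
  rewrite /phi lE /= !mulmx0 !mul0mx !subr0 !mulmx0 !(mxtrace0, addr0, add0r).
  move=> H; rewrite -[RHS]H mulmxDl raddfD /= -!mulmxA; congr (_ + _).
  by rewrite mxtrace_mulC -mulmxA.
have E2 : d2 *m f2 + t2 *m e2 = 0.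
  apply: mxtrace_eq0 => s; have := lphi0 0 s 0.
  rewrite /phi lE /= !mulmx0 !mul0mx !subr0 !mulmx0 !(mxtrace0, addr0, add0r).
  move=> H; rewrite -[RHS]H mulmxDl raddfD /= -!mulmxA; congr (_ + _).
  by rewrite mxtrace_mulC -mulmxA.
have E3 : (d1 + d2) *m f3 + t3 *m (e1 + e2) = 0.
  apply: mxtrace_eq0 => s; have := lphi0 0 0 s.
  rewrite /phi lE /= !mulmx0 !mul0mx !sub0r !mulmxN !raddfN /= -!opprD.
  move=> /eqP; rewrite oppr_eq0 => /eqP H; rewrite -[RHS]H.
  have cyc e : \tr (t3 *m e *m s) = \tr (e *m (s *m t3)).
    by rewrite -mulmxA mxtrace_mulC mulmxA.
  by rewrite !(mulmxDl, mulmxDr) !raddfD /= !cyc -!mulmxA !addrA.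
have [] : exists psi, row_mx e1 e2 = psi *m row_mx f1 f2.
  apply/submxP; apply: (pencil_hom_eq0 E1 E2).
  move: E3; rewrite -f3E -t3E !mulmxDl !mulmxDr !addrA.
  by rewrite [X in X = 0](ACl ((1*5)*(4*8)*(2*3*6*7)))%AC /= E1 E2 !add0r.
(* As e_i = psi f_i, the value of [l] at [y] is the trace of psi (f1 g1 + f2 g2), which is zero by
   [fg0]. *)
move=> psi; rewrite mul_mx_row => /eq_row_mx [psi1 psi2].
rewrite /y lE !mulmx0 !(mxtrace0, add0r) psi1 psi2 -raddfD -!mulmxA -mulmxDr.
by rewrite fg0 mulmx0 /= mxtrace0.
Qed.

End PencilExtensions.

(** * Free and torsion pencils of linear maps *)

Section Pencils.

Variable k : fieldType.
Implicit Types W V : vectType k.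

Definition pencil_free W V (f g : 'Hom(W, V)) :=
  forall X : {vspace W}, X != 0%VS -> (\dim X < \dim (f @: X + g @: X))%N.

(** With rank meaning target dimension minus source dimension, every quotient pencil has rank at
    most 0; pencils of negative rank are included. *)
Definition pencil_torsion W V (f g : 'Hom(W, V)) :=
  forall X : {vspace W},
    (\dim {:V} + \dim X <= \dim {:W} + \dim (f @: X + g @: X))%N.

Import VectorInternalTheory.

Let lfun_mxE W V (f : 'Hom(W, V)) v : v2r (f v) = v2r v *m f2mx f.
Proof. by rewrite unlock r2vK. Qed.

Let dim_mx2vs W m (A : 'M_(m, dim W)) : \dim (mx2vs A : {vspace W}) = \rank A.
Proof. by rewrite /dimv mx2vsK. Qed.

Let dim_limg2 W V (f g : 'Hom(W, V)) m (A : 'M_(m, dim W)) :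
  \dim (f @: mx2vs A + g @: mx2vs A) = \rank (A *m f2mx f + A *m f2mx g)%MS.
Proof.
rewrite unlock /dimv mx2vsK (adds_eqmx (mx2vsK _) (mx2vsK _)).
by rewrite (adds_eqmx (eqmxMr _ (mx2vsK _)) (eqmxMr _ (mx2vsK _))).
Qed.

Lemma pencil_split (Fc F0 Tc T0 : vectType k) (f1 f2 : 'Hom(Fc, F0))
    (t1 t2 : 'Hom(Tc, T0)) (g1 g2 : 'Hom(F0, T0)) :
    pencil_free f1 f2 -> pencil_torsion t1 t2 ->
    (forall v, g1 (f1 v) + g2 (f2 v) = 0) ->
  exists s1 s2 s3 : 'Hom(F0, Tc),
    [/\ forall v, s1 (f1 v) = s3 (f1 v + f2 v),
        forall v, s2 (f2 v) = s3 (f1 v + f2 v),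
        forall v, t1 (s1 v) = g1 v + (t1 (s3 v) + t2 (s3 v)) &
        forall v, t2 (s2 v) = g2 v + (t1 (s3 v) + t2 (s3 v))].
Proof.
move=> f_free t_tors g0.
have f_free' p (Z : 'M_(p, dim Fc)) : Z != 0 ->
    (\rank Z < \rank (Z *m f2mx f1 + Z *m f2mx f2)%MS)%N.
  by rewrite -mxrank_eq0 -dim_mx2vs dimv_eq0 -dim_limg2 => /f_free.
have t_tors' p (A : 'M_(p, dim Tc)) :
    (dim T0 + \rank A <= dim Tc + \rank (A *m f2mx t1 + A *m f2mx t2)%MS)%N.
  by have := t_tors (mx2vs A); rewrite !dimvf dim_limg2 dim_mx2vs.
have [|s1 [s2 [s3 [E1 E2 E3 E4]]]] :=
    @pencil_ext_split _ _ _ _ _ _ _ _ _ f_free' t_tors' (f2mx g1) (f2mx g2).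
  apply/row_matrixP=> i; rewrite row0 rowE mulmxDr !mulmxA.
  have := g0 (r2v (delta_mx 0 i)) => /(congr1 v2r).
  by rewrite !linearE /= !lfun_mxE r2vK.
exists (Hom s1), (Hom s2), (Hom s3); split=> v; apply: v2r_inj.
- by rewrite !linearE /= !lfun_mxE /= -!mulmxA E1 mulmxDl mulmxDr.
- by rewrite !linearE /= !lfun_mxE /= -!mulmxA E2 mulmxDl mulmxDr.
- by rewrite !linearE /= !lfun_mxE /= -!mulmxA E3 !mulmxDr.
by rewrite !linearE /= !lfun_mxE /= -!mulmxA E4 !mulmxDr.
Qed.

End Pencils.

Section SubspaceMaps.

Variables (k : fieldType) (U : vectType k).
Implicit Types A B : {vspace U}.

Lemma lker_vsval A : lker (linfun (vsval : subvs_of A -> U)) == 0%VS.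
Proof. by apply/lker0P => u v; rewrite !lfunE; apply: subvs_inj. Qed.

Lemma limg_vsval_sub A (Z : {vspace subvs_of A}) :
  (linfun (vsval : subvs_of A -> U) @: Z <= A)%VS.
Proof. by apply/subvP => _ /memv_imgP [z _ ->]; rewrite lfunE subvsP. Qed.

Lemma dim_limg_vsval A (Z : {vspace subvs_of A}) :
  \dim (linfun (vsval : subvs_of A -> U) @: Z) = \dim Z.
Proof. by apply: limg_dim_eq; rewrite (eqP (lker_vsval A)) capv0. Qed.

Lemma limg_proj_dim (q : 'End(U)) A B :
    (forall u, q u \in A) -> {in A, q =1 id} ->
  \dim (A + B) = (\dim A + \dim ((\1 - q)%VF @: B))%N.
Proof.
move=> qA q_id; rewrite -(limg_ker_dim (\1 - q)%VF (A + B)).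
have kerE : (lker (\1 - q)%VF = A)%VS.
  apply/vspaceP => u; rewrite memv_ker add_lfunE opp_lfunE id_lfunE subr_eq0.
  by apply/eqP/idP => [-> | /q_id].
rewrite kerE (capv_idPr (addvSl A B)) limgD.
suff -> : ((\1 - q)%VF @: A = 0)%VS by rewrite add0v.
by apply/eqP; rewrite -lkerE kerE.
Qed.

End SubspaceMaps.

(** * Making three projections onto the torsion part agree *)

Section InternalSplitting.

Variables (k : fieldType) (W V : vectType k) (f1 f2 : 'Hom(W, V)).
Variable X : {vspace W}.
Let Y := (f1 @: X + f2 @: X)%VS.
Hypothesis X_min : forall X' : {vspace W},
  (\dim Y + \dim X' <= \dim X + \dim (f1 @: X' + f2 @: X')%VS)%N.
Hypothesis X_max : forall X' : {vspace W}, (X <= X')%VS -> X' != X ->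
  (\dim Y + \dim X' < \dim X + \dim (f1 @: X' + f2 @: X')%VS)%N.

(** Each [q]i is a projection onto [Y] compatible with the i-th arm alone. The corrections [S]i turn
    the three into one common projection q_i - f_i S_i. The obstruction is the pair (q1 - q3, q2 -
    q3), which vanishes on [Y] and so lives on the quotient pencil. That quotient is free by
    [X_max], the pencil (X, Y) is torsion by [X_min], and [pencil_split] applies. *)
Lemma pencil_internal_split (qc : 'End(W)) (q1 q2 q3 : 'End(V)) :
    (forall w, qc w \in X) -> {in X, qc =1 id} ->
    (forall v, [/\ q1 v \in Y, q2 v \in Y & q3 v \in Y]) ->
    {in Y, forall y, [/\ q1 y = y, q2 y = y & q3 y = y]} ->
    (forall w, q1 (f1 w) = f1 (qc w)) -> (forall w, q2 (f2 w) = f2 (qc w)) ->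
    (forall w, q3 (f1 w + f2 w) = f1 (qc w) + f2 (qc w)) ->
  exists S1 S2 S3 : 'Hom(V, W),
    [/\ forall v, [/\ S1 v \in X, S2 v \in X & S3 v \in X],
        {in Y, forall y, [/\ S1 y = 0, S2 y = 0 & S3 y = 0]},
        forall w, S1 (f1 w) = S3 (f1 w + f2 w) /\
                  S2 (f2 w) = S3 (f1 w + f2 w) &
        forall v, q1 v - f1 (S1 v) = q3 v - (f1 (S3 v) + f2 (S3 v)) /\
                  q2 v - f2 (S2 v) = q3 v - (f1 (S3 v) + f2 (S3 v))].
Proof.
move=> qcX qc_id qY q_id q1f q2f q3f.
have q1Y v : q1 v \in Y by case: (qY v).
have q2Y v : q2 v \in Y by case: (qY v).
have q3Y v : q3 v \in Y by case: (qY v).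
have q1_id : {in Y, q1 =1 id} by move=> y /q_id [].
have f1X x : x \in X -> f1 x \in Y.
  by move=> xX; rewrite (subvP (addvSl _ _)) // memv_img.
have f2X x : x \in X -> f2 x \in Y.
  by move=> xX; rewrite (subvP (addvSr _ _)) // memv_img.
(* The kernels [D] and [C] are complements of [X] and [Y] and serve as models of the quotients; [p]
   below is the projection onto [C] along [Y]. *)
pose C := lker q1; pose D := lker qc.
have [p pE] : exists p : 'Hom(V, subvs_of C), forall v, vsval (p v) = v - q1 v.
  exists (linfun (vsproj C) \o (\1 - q1))%VF => v.
  rewrite comp_lfunE lfunE add_lfunE opp_lfunE id_lfunE vsprojK //.
  by rewrite memv_ker linearB /= [q1 (q1 v)]q1_id // subrr.
have [pY pYE] : exists pY : 'Hom(V, subvs_of Y), {in Y, forall v, vsval (pY v) = v}.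
  by exists (linfun (vsproj Y)) => v vY; rewrite lfunE vsprojK.
have pY0 v : v \in Y -> p v = 0.
  by move=> vY; apply: subvs_inj; rewrite pE q1_id // subrr.
pose iD : 'Hom(subvs_of D, W) := linfun vsval.
pose iX : 'Hom(subvs_of X, W) := linfun vsval.
pose iC : 'Hom(subvs_of C, V) := linfun vsval.
pose iY : 'Hom(subvs_of Y, V) := linfun vsval.
have iXE x : iX x = vsval x by rewrite lfunE.
have iDE x : iD x = vsval x by rewrite lfunE.
have iCE x : iC x = vsval x by rewrite lfunE.
have iYE x : iY x = vsval x by rewrite lfunE.
have [||w|s1 [s2 [s3 [E1 E2 E3 E4]]]] :=
  @pencil_split k (subvs_of D) (subvs_of C) (subvs_of X) (subvs_of Y)
    (p \o (f1 \o iD))%VF (p \o (f2 \o iD))%VF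
    (pY \o (f1 \o iX))%VF (pY \o (f2 \o iX))%VF
    (pY \o ((q1 - q3) \o iC))%VF (pY \o ((q2 - q3) \o iC))%VF.
(* Freeness of the quotient: [X_max] for [X + Z'], with dimensions counted modulo [Y] by means of
   [\1 - q1]. *)
- move=> Z nzZ; pose Z' := (iD @: Z)%VS.
  have dZ' : \dim Z' = \dim Z by apply: dim_limg_vsval.
  have XZ' : (X :&: Z' = 0)%VS.
    apply/eqP; rewrite -subv0; apply/subvP => u; rewrite memv_cap memv0.
    case/andP=> uX /(subvP (limg_vsval_sub Z)).
    by rewrite memv_ker qc_id.
  have dX' : \dim (X + Z') = (\dim X + \dim Z)%N.
    by rewrite dimv_disjoint_sum // dZ'.
  have X'X : (X + Z')%VS != X.
    apply: contraNneq nzZ => X'X; rewrite -dimv_eq0.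
    by move: dX'; rewrite X'X => /eqP; rewrite -[X in X == _]addn0 eqn_add2l eq_sym.
  have := X_max (addvSl X Z') X'X; rewrite dX'.
  have -> : (f1 @: (X + Z') + f2 @: (X + Z') =
             Y + (f1 @: Z' + f2 @: Z'))%VS.
    by rewrite !limgD !addvA [LHS](ACl (1*3*2*4))%AC.
  rewrite (limg_proj_dim _ q1Y q1_id).
  rewrite -(dim_limg_vsval (_ + _)%VS) -/iC !limgD -!limg_comp.
  have eqR f : (iC \o (p \o (f \o iD)))%VF = ((\1 - q1) \o (f \o iD))%VF.
    apply/lfunP => z; rewrite !comp_lfunE iCE pE.
    by rewrite add_lfunE opp_lfunE id_lfunE.
  by rewrite !eqR !comp_lfunA addnCA !ltn_add2l.
- move=> Z; have := X_min (iX @: Z)%VS.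
  rewrite dim_limg_vsval [\dim {: subvs_of Y}]dimvf [\dim {: subvs_of X}]dimvf.
  rewrite -(dim_limg_vsval (_ + _)%VS) -/iY limgD -!limg_comp.
  suff eqR (f : 'Hom(W, V)) : (forall x, x \in X -> f x \in Y) ->
      (iY \o (pY \o (f \o iX)))%VF = (f \o iX)%VF by rewrite !eqR.
  move=> fX; apply/lfunP => z; rewrite !comp_lfunE iYE pYE //.
  by rewrite fX // iXE subvsP.
- apply: subvs_inj; rewrite !comp_lfunE -linearD pYE; last first.
    by rewrite !add_lfunE !opp_lfunE; apply: memvD; apply: memvB.
  have := subvsP w; rewrite memv_ker => /eqP qw.
  have {}q1f : q1 (f1 (vsval w)) = 0 by rewrite q1f qw linear0.
  have {}q2f : q2 (f2 (vsval w)) = 0 by rewrite q2f qw linear0.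
  have {}q3f : q3 (f1 (vsval w)) + q3 (f2 (vsval w)) = 0.
    by have := q3f (vsval w); rewrite linearD qw !linear0 addr0.
  rewrite !add_lfunE !opp_lfunE !iCE !pE !iDE q1f subr0 !linearB /= q1f q2f.
  have [_ -> ->] := q_id _ (q1Y (f2 (vsval w))).
  by rewrite !sub0r opprK (addrCA (- q1 _)) addNr addr0 -opprD q3f oppr0.
pose S (s : 'Hom(subvs_of C, subvs_of X)) : 'Hom(V, W) := (iX \o (s \o p))%VF.
have SE s v : S s v = vsval (s (p v)) by rewrite !comp_lfunE iXE.
exists (S s1), (S s2), (S s3).
have qK i c : i = q1 \/ i = q2 -> (i - q3) (vsval (p c)) = i c - q3 c.
  move=> iE; rewrite pE linearB /= !add_lfunE !opp_lfunE.
  have [q1c q2c q3c] := q_id _ (q1Y c).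
  suff -> : i (q1 c) = q3 (q1 c) by rewrite subrr subr0.
  by rewrite q3c; case: iE => ->.
split.
- by move=> v; rewrite !SE !subvsP.
- by move=> y yY; rewrite !SE pY0 // !linear0.
- move=> w; have [d dE] : exists d : subvs_of D, w - qc w = vsval d.
    exists (vsproj D (w - qc w)); rewrite vsprojK // memv_ker linearB /=.
    by rewrite [qc (qc w)]qc_id ?subrr.
  have pf (f : 'Hom(W, V)) : (forall x, x \in X -> f x \in Y) ->
      p (f w) = (p \o (f \o iD))%VF d.
    move=> fX; rewrite !comp_lfunE iDE -dE linearB linearB /=.
    by rewrite [p (f (qc w))]pY0 ?subr0 // fX.
  by rewrite !SE linearD /= !pf // E1 E2.
have f1iX x : f1 (iX x) \in Y by rewrite f1X // iXE subvsP.
have f2iX x : f2 (iX x) \in Y by rewrite f2X // iXE subvsP.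
have q13Y u : (q1 - q3) u \in Y by rewrite !add_lfunE !opp_lfunE memvB.
have q23Y u : (q2 - q3) u \in Y by rewrite !add_lfunE !opp_lfunE memvB.
move=> v; have := E3 (p v); have := E4 (p v).
move=> /(congr1 vsval); rewrite !comp_lfunE !linearD /= !pYE // => {}E4.
move=> /(congr1 vsval); rewrite !linearD /= !pYE // => {}E3.
rewrite iCE qK in E3; last by left.
rewrite iCE qK in E4; last by right.
by rewrite E3 E4 !opprD !opprK !addrA !subrr !add0r.
Qed.


End InternalSplitting.

(** * Splitting off the torsion submodule *)

Lemma exists_minimizer T (m : T -> nat) (x0 : T) :
  exists x, forall y, (m x <= m y)%N.
Proof.
have [n] := ubnP (m x0); elim: n x0 => // n IHn x0 lt_n.
have [[y lt_y]|no_y] := classic (exists y, (m y < m x0)%N).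
  by apply: (IHn y); apply: leq_trans lt_y lt_n.
by exists x0 => y; rewrite leqNgt; apply/negP => lt_y; apply: no_y; exists y.
Qed.

Lemma exists_pencil_torsion (k : fieldType) (W V : vectType k)
    (f g : 'Hom(W, V)) (img := fun X => (f @: X + g @: X)%VS) :
  exists X : {vspace W},
    (forall X', \dim (img X) + \dim X' <= \dim X + \dim (img X'))%N /\
    (forall X', (X <= X')%VS -> X' != X ->
      \dim (img X) + \dim X' < \dim X + \dim (img X'))%N.
Proof.
pose n := \dim {:W}.
(* A lexicographic order in one number: first the image dimension minus that of X, shifted by n to
   stay in nat, then, among equals, larger X first. The factor [n.+1] exceeds every value of the
   second entry. *)
pose m (X : {vspace W}) := ((\dim (img X) + (n - \dim X)) * n.+1 + (n - \dim X))%N.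
have [X minX] := exists_minimizer m 0%VS; exists X.
have dn (U : {vspace W}) : (\dim U <= n)%N by rewrite dimvS ?subvf.
split=> X'.
  have := minX X'; rewrite /m; have := dn X; have := dn X'; nia.
move=> XX' neX; have ltd : (\dim X < \dim X')%N.
  by rewrite ltn_neqAle dimvS // andbT (dimv_leqif_eq XX') eq_sym.
have := minX X'; rewrite /m; have := dn X; have := dn X'; nia.
Qed.

(** * Recursion along the arms *)

Section Arms.

Variables (k : fieldType) (t : nat) (L : canonical_data k t).

Lemma arm_endP (i : 'I_t) (j : 'I_(weight L i).-1) :
  ~ (j.+1 < (weight L i).-1)%N -> j.+2 = weight L i.
Proof.
by move=> /negP; case: j => j /=; case: (weight L i) => [|[|p]] //=; lia.
Qed.

(** The target depends on whether [j] is the last inner vertex, hence the dependent pair; matching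
    on [decP] supplies the proof that each arrow carries. *)
Definition next_arrow (i : 'I_t) (j : 'I_(weight L i).-1) :
    {w : vertex L & arrow (vmid j) w} :=
  match @decP _ _ (@idP (j.+1 < (weight L i).-1)%N) with
  | left lt_j =>
      existT _ (vmid (Ordinal lt_j)) (@amid _ _ L i j (Ordinal lt_j) erefl)
  | right ge_j => existT _ (vc L) (@alast _ _ L i j (arm_endP ge_j))
  end.

(** Uniqueness of the arrow leaving an inner vertex: the equations stored in arrows are between
    natural numbers, so their proofs are irrelevant. *)
Lemma next_arrowP v w (a : arrow v w) :
  match v as v return arrow v w -> Prop with
  | vmid i j => fun a => next_arrow j = existT _ w a
  | _ => fun=> True
  end a.
Proof.
case: v w / a => // i j.
  move=> j' j'E; rewrite /next_arrow; case: decP => [lt_j|[]]; last first.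
    by have := ltn_ord j'; rewrite j'E.
  have E : j' = Ordinal lt_j by apply: val_inj.
  by case: _ / (esym E) j'E => j'E; rewrite (eq_irrelevance j'E erefl).
move=> jE; rewrite /next_arrow; case: decP => [lt_j|ge_j].
  by exfalso; move: jE lt_j; lia.
by rewrite (eq_irrelevance (arm_endP ge_j) jE).
Qed.

(** On inner vertices this is the number of arrows to [vc]. The value at [vzero], where several arms
    start, is a default. *)
Definition depth (v : vertex L) : nat :=
  if v is vmid i j then ((weight L i).-1 - j)%N else 0.

Lemma depth_next v w (a : arrow v w) : v <> vzero L -> depth v = (depth w).+1.
Proof.
case: v w / a => // i j; first by move=> j' j'E _ /=; have := ltn_ord j'; lia.
by move=> jE _ /=; have := ltn_ord j; lia.
Qed.

Lemma arrow_target v w : arrow v w -> w <> vzero L.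
Proof. by case. Qed.

Lemma arm_ind (P : vertex L -> Prop) :
    P (vc L) ->
    (forall v w (a : arrow v w), v <> vzero L -> P w -> P v) ->
  forall v, v <> vzero L -> P v.
Proof.
move=> Pc Pstep v; have [n] := ubnP (depth v); elim: n v => // n IHn v.
case: v => // i j lt_n nz_v; have [w a] := next_arrow j.
have nz_w := arrow_target a.
by apply: (Pstep _ _ a) => //; apply: IHn => //; move: lt_n; rewrite (depth_next a).
Qed.

Section Recursion.

Variables (B : vertex L -> Type) (b : forall v, B v).
Variable step : forall v w, arrow v w -> B w -> B v.

(** With fuel [depth v] an inner vertex never runs out, so [b] is read only at [vc] and at
    [vzero]. *)
Fixpoint arm_rec_fuel (n : nat) (v : vertex L) : B v :=
  match v with
  | vmid i j => if n is n'.+1 then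
       step (projT2 (next_arrow j)) (arm_rec_fuel n' _)
     else b (vmid j)
  | v => b v
  end.

Definition arm_rec v := arm_rec_fuel (depth v) v.

Lemma arm_recE v w (a : arrow v w) :
  v <> vzero L -> arm_rec v = step a (arm_rec w).
Proof.
move=> v_mid; rewrite /arm_rec (depth_next a v_mid).
case: v w / a v_mid (next_arrowP a) => [i j _ /(_ erefl)//|i j j' jE _|i j jE _].
  by move=> /= ->.
by move=> /= ->.
Qed.

End Recursion.

End Arms.

Notation arm0 := (@Ordinal 3 0 isT).
Notation arm1 := (@Ordinal 3 1 isT).
Notation arm2 := (@Ordinal 3 2 isT).

Lemma arms_ind (P : 'I_3 -> Prop) : P arm0 -> P arm1 -> P arm2 -> forall i, P i.
Proof.
move=> P0 P1 P2 [[|[|[|m]]] lt_i] //.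
- by rewrite (_ : Ordinal _ = arm0) //; apply: val_inj.
- by rewrite (_ : Ordinal _ = arm1) //; apply: val_inj.
by rewrite (_ : Ordinal _ = arm2) //; apply: val_inj.
Qed.

Section Complements.

Variables (k : fieldType) (U : vectType k).
Implicit Types A B C T : {vspace U}.

Lemma compl_extend A T (C := (A + (A + T)^C)%VS) :
  (A :&: T = 0)%VS -> (C + T = fullv)%VS /\ (C :&: T = 0)%VS.
Proof.
move=> AT; have CT : (C + T = fullv)%VS.
  by rewrite /C -addvA [(_^C + T)%VS]addvC addvA addv_complf.
split=> //; apply/eqP; rewrite -dimv_eq0; have := dimv_sum_cap C T.
rewrite CT; have := dimv_sum_cap A T; rewrite AT dimv0.
have := dimv_compl (A + T)%VS; have := dimvS (subvf (A + T)%VS).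
by have [+ _] := dimv_add_leqif A (A + T)^C%VS; rewrite -/C; lia.
Qed.

Lemma proj_along A B (p := daddv_pi A B) :
    (B + A = fullv)%VS -> (B :&: A = 0)%VS ->
  [/\ forall u, p u \in A, {in A, p =1 id}, {in B, forall u, p u = 0} &
      forall u, u - p u \in B].
Proof.
move=> BA BA0; have AB0 : (A :&: B = 0)%VS by rewrite capvC.
have pE u : p u + daddv_pi B A u = u.
  by rewrite daddv_pi_add // addvC BA memvf.
split=> [u|u|u uB|u]; first exact: memv_pi.
- exact: daddv_pi_id.
- by apply: (@addIr _ u); rewrite add0r -[RHS]pE [daddv_pi B A u]daddv_pi_id.
by rewrite -[X in X - _]pE addrC addKr memv_pi.
Qed.

(** The new complement is the graph of a map from [C] to [T]: if c + s c lies in [T] then so does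
    c. *)
Lemma compl_shift (s : 'End(U)) C T :
    (forall u, s u \in T) -> (C + T = fullv)%VS -> (C :&: T = 0)%VS ->
  ((\1 + s)%VF @: C + T = fullv)%VS /\ ((\1 + s)%VF @: C :&: T = 0)%VS.
Proof.
move=> sT CT CT0.
have sE u : (\1 + s)%VF u = u + s u by rewrite add_lfunE id_lfunE.
split; apply/vspaceP => u.
  rewrite memvf; have /memv_addP [c cC [x xT ->]] : u \in (C + T)%VS by rewrite CT memvf.
  have -> : c + x = (\1 + s)%VF c + (x - s c) by rewrite sE addrACA subrr addr0.
  by rewrite memv_add ?memv_img ?memvB.
rewrite memv_cap memv0; apply/andP/eqP => [[/memv_imgP [c cC ->] cT] | ->].
  have : c \in (C :&: T)%VS.
    by rewrite memv_cap cC -(addrK (s c) c) -sE memvB.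
  by rewrite CT0 memv0 => /eqP ->; rewrite linear0.
by rewrite !mem0v.
Qed.

End Complements.

Section ModuleMaps.

Variables (k : fieldType) (t : nat) (L : canonical_data k t).
Variable M : canonical_module L.

(** The zero at [vc] is a default: there the arms give different composites, namely the maps
    [arm_map]. *)
Definition iota v : 'Hom(M v, M (vzero L)) :=
  match v with
  | vzero => \1%VF
  | vmid i (Ordinal m lt_m) => inner_map (action M) lt_m
  | vc => 0
  end.

Lemma iota_first (i : 'I_t) (j : 'I_(weight L i).-1) (jE : j = 0%N :> nat) x :
  iota (vmid j) x = action M (afirst jE) x.
Proof.
case: j jE x => m lt_m /= mE; have E0 := esym mE.
case: _ / E0 lt_m mE => lt_m mE x /=.
by rewrite (eq_irrelevance mE erefl).
Qed.

Lemma iota_mid (i : 'I_t) (j j' : 'I_(weight L i).-1) (jE : j' = j.+1 :> nat) x :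
  iota (vmid j') x = iota (vmid j) (action M (amid jE) x).
Proof.
case: j' jE x => m' lt_m'; case: j => m lt_m /= mE.
have E0 := esym mE; case: _ / E0 lt_m' mE => lt_m' mE x /=; rewrite comp_lfunE.
by rewrite (eq_irrelevance mE erefl) (bool_irrelevance lt_m (ltnW lt_m')).
Qed.

Lemma iota_last (i : 'I_t) (j : 'I_(weight L i).-1) (jE : j.+2 = weight L i) x :
  arm_map (action M) i x = iota (vmid j) (action M (alast jE) x).
Proof.
have E : j = Ordinal (last_inner_lt L i) by apply: val_inj; move: jE => /=; lia.
have E0 := esym E; case: _ / E0 jE => jE; rewrite comp_lfunE /=.
by rewrite (eq_irrelevance jE (last_innerE L i)).
Qed.

(** The composite from [vc] along the arm; at [vzero] it has the default value 0. *)
Definition kappa : forall v, 'Hom(M (vc L), M v) :=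
  @arm_rec _ _ L (fun v => 'Hom(M (vc L), M v))
    (fun v => if v is vc then \1%VF else 0) (fun v w a g => (action M a \o g)%VF).

Lemma kappaE v w (a : arrow v w) x :
  v <> vzero L -> kappa v x = action M a (kappa w x).
Proof. by move=> nz_v; rewrite /kappa (arm_recE _ _ a nz_v) comp_lfunE. Qed.

Lemma kappa_c x : kappa (vc L) x = x.
Proof. by rewrite id_lfunE. Qed.

Lemma iota_kappa (i : 'I_t) (j : 'I_(weight L i).-1) x :
  iota (vmid j) (kappa (vmid j) x) = arm_map (action M) i x.
Proof.
pose P v := match v with
  | vmid i j => iota (vmid j) (kappa (vmid j) x) = arm_map (action M) i x
  | _ => True
  end.
suff: P (vmid j) by []; apply: (@arm_ind _ _ L P) => // v w a.
case: v w / a => // {}i {}j; last first.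
  by move=> jE _ _; rewrite /P (iota_last jE) (kappaE (alast jE)) // kappa_c.
by move=> j' jE _ IH; rewrite /P (kappaE (amid jE)) // -iota_mid.
Qed.


End ModuleMaps.
Arguments iota : simpl never.

Section TorsionSplitting.

Variables (k : fieldType) (L : canonical_data k 3) (M : canonical_module L).

Let W := M (vc L).
Let V := M (vzero L).
Let f (i : 'I_3) : 'Hom(W, V) := arm_map (action M) i.
Let f1 := f arm0.
Let f2 := f arm1.

Lemma arm2E x : arm_map (action M) arm2 x =
  arm_map (action M) arm0 x + arm_map (action M) arm1 x.
Proof.
rewrite (action_relations M (i1 := arm0) (i2 := arm1)) // add_lfunE.
by rewrite param_normalized // scale1r.
Qed.

Section FixedX.

Variable X : {vspace W}.
Let Y := (f1 @: X + f2 @: X)%VS.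
Hypothesis X_min : forall X' : {vspace W},
  (\dim Y + \dim X' <= \dim X + \dim (f1 @: X' + f2 @: X')%VS)%N.
Hypothesis X_max : forall X' : {vspace W}, (X <= X')%VS -> X' != X ->
  (\dim Y + \dim X' < \dim X + \dim (f1 @: X' + f2 @: X')%VS)%N.

Let fX i x : x \in X -> f i x \in Y.
Proof.
have f1X : x \in X -> f1 x \in Y.
  by move=> xX; rewrite (subvP (addvSl _ _)) // memv_img.
have f2X : x \in X -> f2 x \in Y.
  by move=> xX; rewrite (subvP (addvSr _ _)) // memv_img.
move: i; apply: arms_ind => // xX.
by rewrite /f arm2E memvD ?f1X ?f2X.
Qed.

(** If f_i x is in [Y], then f_1 x and f_2 x span at most a line modulo [Y], because f_3 = f_1 +
    f_2. Adding [x] to [X] would then raise the dimension of the image by at most one, against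
    [X_max]. *)
Let fY_X i x : f i x \in Y -> x \in X.
Proof.
move=> fxY; apply: contraT => xX.
have [z zE] : exists z : V, (f1 @: (X + <[x]>) + f2 @: (X + <[x]>) <= Y + <[z]>)%VS.
  exists (if i == arm0 then f2 x else f1 x).
  have Yz : (Y <= Y + <[if i == arm0 then f2 x else f1 x]>)%VS := addvSl _ _.
  have f1Y : (f1 @: X <= Y)%VS := addvSl _ _.
  have f2Y : (f2 @: X <= Y)%VS := addvSr _ _.
  rewrite !limgD !limg_line !subv_add (subv_trans f1Y Yz) (subv_trans f2Y Yz) /= -!memvE.
  have zz v : v \in (Y + <[v]>)%VS by rewrite (subvP (addvSr Y _)) ?memv_line.
  move: i fxY Yz; apply: arms_ind => /= fxY /subvP Yz.
  - by rewrite zz Yz.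
  - by rewrite zz Yz.
  rewrite zz /= -[f2 x](addKr (f1 x)) -arm2E addrC memv_add //.
  by rewrite memvN memv_line.
have xX' : (X + <[x]>)%VS != X.
  apply: contra xX => /eqP <-.
  by rewrite (subvP (addvSr X <[x]>)) ?memv_line.
have := X_max (addvSl X <[x]>) xX'.
have dX : (\dim X < \dim (X + <[x]>))%N.
  by rewrite ltn_neqAle dimvS ?addvSl // andbT (dimv_leqif_eq (addvSl _ _)) eq_sym.
have := dimvS zE; have [+ _] := dimv_add_leqif Y <[z]>.
rewrite dim_vline; case: (z != 0); lia.
Qed.

(** At inner vertices this is everything that reaches [Y], kernels of [iota] included, and not only
    the image of [X]; so arrows between the remaining vertices become injective modulo [T]. *)
Let T v : {vspace M v} :=
  match v with vc => X | v => (iota M v @^-1: Y)%VS end.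

Let T_zero : T (vzero L) = Y.
Proof. by apply/vspaceP => y; rewrite -memv_preim id_lfunE. Qed.

Let T_submodule : submodule T.
Proof.
move=> v w a; apply/subvP => _ /memv_imgP [x + ->].
case: v w / a x => i j; [move=> jE x | move=> j' jE x | move=> jE x].
- by rewrite T_zero -memv_preim (@iota_first _ _ _ M _ _ jE).
- by rewrite -!memv_preim (@iota_mid _ _ _ M _ _ _ jE).
by rewrite -memv_preim -iota_last; apply: fX.
Qed.

Let T_action v w (a : arrow v w) x :
  v <> vzero L -> action M a x \in T v -> x \in T w.
Proof.
case: v w / a x => i j; [by move=> jE x /(_ erefl) | move=> j' jE x _ | move=> jE x _].
  by rewrite -!memv_preim (@iota_mid _ _ _ M _ _ _ jE).
by rewrite -memv_preim -iota_last; apply: fY_X.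
Qed.

(** Complements of [T] chosen from [vc] towards [vzero], each containing the image of the previous
    one; they respect all arrows except those acting into [M (vzero L)]. *)
Let C := @arm_rec _ _ L (fun v => {vspace M v}) (fun v => (T v)^C%VS)
  (fun v w a A => (action M a @: A + (action M a @: A + T v)^C)%VS).

Let C_compl v : v <> vzero L -> (C v + T v = fullv)%VS /\ (C v :&: T v = 0)%VS.
Proof.
move: v; apply: arm_ind => [|v w a nz_v [_ CT0]].
  by rewrite addvC addv_complf capvC capv_compl.
rewrite /C (arm_recE _ _ a nz_v) -/(C w); apply: compl_extend.
apply/eqP; rewrite -subv0; apply/subvP => _ /memv_capP [/memv_imgP [x xC ->] xT].
have : x \in (C w :&: T w)%VS by rewrite memv_cap xC (T_action _ xT).
by rewrite CT0 memv0 => /eqP ->; rewrite linear0 mem0v.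
Qed.

Let C_action v w (a : arrow v w) x :
  v <> vzero L -> x \in C w -> action M a x \in C v.
Proof.
move=> nz_v xC; rewrite /C (arm_recE _ _ a nz_v) -/(C w).
by rewrite (subvP (addvSl _ _)) ?memv_img.
Qed.

Let C_kappa v x : v <> vzero L -> x \in C (vc L) -> kappa M v x \in C v.
Proof.
move=> nz_v xC; move: v nz_v; apply: arm_ind => [|v w a nz_v IH].
  by rewrite kappa_c.
by rewrite (@kappaE _ _ _ M _ _ a) // C_action.
Qed.

Let T_kappa v x : v <> vzero L -> x \in X -> kappa M v x \in T v.
Proof.
move=> nz_v xC; move: v nz_v; apply: arm_ind => [|v w a nz_v IH].
  by rewrite kappa_c.
by rewrite (@kappaE _ _ _ M _ _ a) // (subvP (T_submodule a)) // memv_img.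
Qed.

Lemma first_inner_lt (i : 'I_3) : (0 < (weight L i).-1)%N.
Proof. by have := weight_ge2 L i; lia. Qed.

Let first i := vmid (Ordinal (first_inner_lt i)).
(** A complement of [T] that is a submodule must absorb the image of every arm in [V]. The space
    [E i] below is a complement of [Y] that does so for arm i only; reconciling the three is the
    real task. *)
Let D i : {vspace V} := (iota M (first i) @: C (first i))%VS.
Let E i : {vspace V} := (D i + (D i + Y)^C)%VS.

Let DY0 i : (D i :&: Y = 0)%VS.
Proof.
apply/eqP; rewrite -subv0; apply/subvP => _ /memv_capP [/memv_imgP [x xC ->] xY].
have [//|_ CT0] := @C_compl (first i).
have : x \in (C (first i) :&: T (first i))%VS by rewrite memv_cap xC -memv_preim.
by rewrite CT0 memv0 => /eqP ->; rewrite linear0 mem0v.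
Qed.

(** The common projection [r] from [pencil_internal_split] provides one complement [lker r] in [V],
    and the complements [C v] are moved by graphs so as to map into it. *)
Lemma torsion_splits : exists N : forall v, {vspace M v},
  [/\ submodule T, submodule N &
      forall v, (T v + N v = fullv)%VS /\ (T v :&: N v = 0)%VS].
Proof.
have [Cc_full Cc0] := @C_compl (vc L) ltac:(done).
have [qcX qc_id qc0 qcC] := proj_along Cc_full Cc0.
set qc := daddv_pi _ _ in qcX qc_id qc0 qcC.
pose q i := daddv_pi Y (E i).
have qP i := let: conj a b := compl_extend (DY0 i) in proj_along a b.
have qY i v : q i v \in Y by have [] := qP i.
have q_id i : {in Y, q i =1 id} by have [] := qP i.
have qE i : {in E i, forall u, q i u = 0} by have [] := qP i.
have fD i x : x \in C (vc L) -> f i x \in D i.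
  move=> xC; rewrite /f -(@iota_kappa _ _ _ M i (Ordinal (first_inner_lt i))).
  by rewrite memv_img // C_kappa.
have qf i x : q i (f i x) = f i (qc x).
  rewrite -{1}[x](subrK (qc x)) linearD linearD /= qE.
    by rewrite add0r [q i _]q_id // fX.
  by rewrite (subvP (addvSl _ _)) // fD.
have [|||||||S1 [S2 [S3 [SX SY Sf Sq]]]] :=
  @pencil_internal_split k W V f1 f2 X X_min X_max qc (q arm0) (q arm1) (q arm2) => //.
- by move=> y yY; split; apply: q_id.
- by move=> w; rewrite -!arm2E; apply: qf.
pose S (i : 'I_3) := if i == arm0 then S1 else if i == arm1 then S2 else S3.
have {}SX i v : S i v \in X by rewrite /S; have [] := SX v; case: (i == _); case: (i == _).
have {}SY i : {in Y, forall y, S i y = 0}.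
  by move=> y /SY []; rewrite /S; case: (i == _); case: (i == _).
pose r := (q arm2 - (f arm2 \o S arm2))%VF.
have rE i v : r v = q i v - f i (S i v).
  rewrite add_lfunE opp_lfunE comp_lfunE; move: i.
  by have [E0 E1] := Sq v; apply: arms_ind; rewrite /S /= {1}/f arm2E ?E0 ?E1.
pose Sc := (S arm0 \o f arm0)%VF.
have ScE i w : Sc w = S i (f i w).
  rewrite comp_lfunE; move: i; have [E0 E1] := Sf w.
  by apply: arms_ind; rewrite /S /= ?E1 ?E0 // /f arm2E.
(* For c in [C v] at a first inner vertex and y its image in [V], the shifted vector maps to y + f_i
   (S_i y). There q_i y = 0 and [r] is the identity on [Y], so [r] kills it. By [ScE] the shift at
   [vc] is the same for all arms. *)
pose s v : 'End(M v) := match v with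
  | vzero => 0
  | vmid i j => (kappa M (vmid j) \o (S i \o iota M (vmid j)))%VF
  | vc => Sc
  end.
pose N v : {vspace M v} := match v with
  | vzero => lker r
  | v => ((\1 + s v)%VF @: C v)%VS
  end.
exists N; split=> //.
  move=> v w a; apply/subvP => _ /memv_imgP [x + ->].
  case: v w / a x => i j.
  - move=> jE _ /memv_imgP [x xC ->]; rewrite memv_ker.
    rewrite -iota_first add_lfunE id_lfunE !comp_lfunE linearD /= iota_kappa -/f.
    have jfirst : j = Ordinal (first_inner_lt i) by apply: val_inj.
    have yD : iota M (vmid j) x \in D i.
      by rewrite jfirst in x xC *; rewrite memv_img.
    rewrite -/(f i); move: (iota M (vmid j) x) yD => y yD.
    rewrite (rE i) [q i _]linearD /= qE ?(subvP (addvSl _ _)) // add0r.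
    by rewrite q_id ?fX // linearD /= [S i (f i _)]SY ?fX // addr0 subrr.
  - move=> j' jE _ /memv_imgP [x xC ->]; rewrite add_lfunE id_lfunE !comp_lfunE.
    apply/memv_imgP; exists (action M (amid jE) x); first exact: C_action.
    rewrite add_lfunE id_lfunE !comp_lfunE linearD /= -iota_mid.
    by rewrite -(@kappaE _ _ _ M _ _ (amid jE)).
  move=> jE _ /memv_imgP [x xC ->]; rewrite add_lfunE id_lfunE (ScE i).
  apply/memv_imgP; exists (action M (alast jE) x); first exact: C_action.
  rewrite add_lfunE id_lfunE linearD /= [in RHS]comp_lfunE (comp_lfunE (S i)).
  by rewrite (@kappaE _ _ _ M _ _ (alast jE)) // kappa_c -(@iota_last _ _ _ M _ _ jE).
have rY v : r v \in Y by rewrite (rE arm0) memvB // fX.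
have r_id : {in Y, r =1 id}.
  by move=> y yY; rewrite (rE arm0) q_id // SY // linear0 subr0.
move=> v; rewrite addvC capvC; case: v => [|i j|].
- rewrite /N T_zero; split; apply/vspaceP => v.
    rewrite memvf -(subrK (r v) v) memv_add // memv_ker linearB /=.
    by rewrite [r (r v)]r_id // subrr.
  rewrite memv_cap memv_ker memv0; apply/andP/eqP => [[/eqP rv0 vY] | ->].
    by rewrite -[v]r_id.
  by rewrite linear0 mem0v.
- have [//|Cj Cj0] := @C_compl (vmid j); apply: compl_shift => // x.
  by rewrite !comp_lfunE T_kappa.
by apply: compl_shift => // x; rewrite comp_lfunE.
Qed.


End FixedX.
End TorsionSplitting.

Section TorsionFree.

Variables (k : fieldType) (L : canonical_data k 3) (M : canonical_module L).
Let f i := arm_map (action M) i.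

(** One of the summands [T] and [N] is zero. If [N] is, then X = W and Y = V, and comparing [X] with
    the zero subspace gives dim V <= dim W, contrary to positive rank. If [T] is, then X = 0, so
    [X_max] is freeness and the preimages of 0 under [iota] vanish. *)
Theorem indecomposable_torsion_free :
    indecomposable M -> (0 < rank M)%R ->
  pencil_free (f arm0) (f arm1) /\
  forall v, v <> vc L -> lker (iota M v) = 0%VS.
Proof.
move=> [_ indec] rk_gt0.
have [X [X_min X_max]] := exists_pencil_torsion (f arm0) (f arm1).
have [N [subT subN TN]] := torsion_splits X_min X_max.
have := X_min 0%VS; rewrite !limg0 addv0 !dimv0 !addn0 => leYX.
have [T0|N0] := indec _ _ subT subN TN.
  have X0 : X = 0%VS := T0 (vc L).
  have Y0 : (f arm0 @: X + f arm1 @: X)%VS = 0%VS.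
    by rewrite X0 !limg0 addv0.
  split=> [X' nzX'|v nc_v]; last first.
    by case: v nc_v (T0 v) => [|i j|] /= nc_v; rewrite ?[X in (_ @^-1: X)%VS]Y0 ?lpreim0 //.
  by have := X_max X'; rewrite Y0 X0 !dimv0 sub0v nzX' !add0n => /(_ isT isT).
have := TN (vc L); rewrite N0 addv0 => -[XW _].
have := TN (vzero L); rewrite N0 addv0 => -[YV _].
have {}YV : (f arm0 @: X + f arm1 @: X)%VS = fullv.
  by apply/vspaceP => y; rewrite memvf -[RHS](memvf y) -YV -memv_preim id_lfunE.
by move: rk_gt0; rewrite /rank subr_gt0 ltz_nat -YV -XW ltnNge leYX.
Qed.

End TorsionFree.

(** * Free pencils as sums of chains *)

Section ChainFrames.

Variable k : fieldType.

(** Phrased through subspaces so that linear changes of the two families need no manipulation of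
    lists. *)
Definition spanning (U : vectType k) a b (x y : nat -> U) :=
  forall S : {vspace U}, (forall j, (j < a)%N -> x j \in S) ->
    (forall j, (j < b)%N -> y j \in S) -> S = fullv.

(** The pencil of O(a): as monomials of degree a - 1 and a, [g] keeps the index and [f] raises
    it. *)
Definition chain (W V : vectType k) (f g : 'Hom(W, V)) a
    (x : nat -> V) (w : nat -> W) :=
  forall j, (j < a)%N -> f (w j) = x j.+1 /\ g (w j) = x j.

(** Here [a] and [b] count the vectors in [V]. A nonempty chain has one vector fewer in [W], and the
    truncated predecessor also admits an empty chain. *)
Record chain_frame (W V : vectType k) (f g : 'Hom(W, V)) a b
    (x y : nat -> V) (w w' : nat -> W) : Prop := ChainFrame {
  frame_chain_l : chain f g a.-1 x w;
  frame_chain_r : chain f g b.-1 y w';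
  frame_span : spanning a b x y;
  frame_span_source : spanning a.-1 b.-1 w w';
  frame_dim : \dim {:V} = (a + b)%N;
  frame_dim_source : \dim {:W} = (a.-1 + b.-1)%N
}.

Lemma pencil_free_inj (W V : vectType k) (f g : 'Hom(W, V)) :
  pencil_free f g -> lker f = 0%VS /\ lker g = 0%VS.
Proof.
move=> fg; have line_lt x : x != 0 -> (1 < \dim (<[f x]> + <[g x]>))%N.
  by move=> nz; have := fg <[x]>%VS; rewrite -dimv_eq0 dim_vline nz !limg_line; apply.
split; apply/eqP; rewrite -subv0; apply/subvP => x; rewrite memv_ker memv0.
  apply: contraLR => /line_lt; apply: contraTN => /eqP ->.
  by rewrite add0v dim_vline -leqNgt leq_b1.
apply: contraLR => /line_lt; apply: contraTN => /eqP ->.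
by rewrite addv0 dim_vline -leqNgt leq_b1.
Qed.

Lemma chain_frame_point (W V : vectType k) (f g : 'Hom(W, V)) :
    \dim {:W} = 0%N -> (\dim {:V} <= 2)%N ->
  exists a b x y w w', (b <= a)%N /\ chain_frame f g a b x y w w'.
Proof.
move=> W0 leV; set n := \dim {:V} in leV.
pose e i := nth 0 (vbasis {:V}) i.
exists (0 < n)%N, (1 < n)%N, (fun=> e 0%N), (fun=> e 1%N), (fun=> 0), (fun=> 0).
split; first by case: n leV => [|[|]].
split.
- by move=> j; case: (0 < n)%N.
- by move=> j; case: (1 < n)%N.
- move=> S xS yS; apply/eqP; rewrite eqEsubv subvf /=.
  rewrite -(span_basis (vbasisP fullv)); apply/span_subvP => v.
  case/(nthP 0) => i; rewrite size_tuple -/n => lt_i <-; rewrite -/(e i).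
  case: i lt_i => [|[|i]] lt_i; first by apply: (xS 0%N); rewrite lt_i.
    by apply: (yS 0%N); rewrite lt_i.
  by have := leq_trans lt_i leV.
- move=> S _ _; apply/eqP; rewrite eqEdim subvf.
  by rewrite W0.
- by rewrite -/n; case: n leV => [|[|[|]]].
by rewrite W0; case: (0 < n)%N; case: (1 < n)%N.
Qed.

(* [K] is the source of the twist by O(-1) of the pencil, whose target is [W]. *)
Lemma pencil_free_shift (W V : vectType k) (f g : 'Hom(W, V))
    (K := (g @^-1: limg f)%VS) (i : 'Hom(subvs_of K, W)) :
  pencil_free f g -> (forall u, i u = vsval u) -> pencil_free i (f^-1 \o (g \o i))%VF.
Proof.
move=> fg iE Z nzZ; have [f_inj g_inj] := pencil_free_inj fg.
set i' := (f^-1 \o _)%VF; set P := (i @: Z + i' @: Z)%VS.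
have i_inj : lker i = 0%VS.
  by apply/eqP/lker0P => u v; rewrite !iE; apply: subvs_inj.
have dimI (U1 U2 : vectType k) (h : 'Hom(U1, U2)) S :
  lker h = 0%VS -> \dim (h @: S) = \dim S by move=> h0; rewrite limg_dim_eq // h0 capv0.
have nzP : P != 0%VS.
  apply: contra nzZ; rewrite -!dimv_eq0 => P0.
  by have := dimvS (addvSl (i @: Z) (i' @: Z)); rewrite (eqP P0) dimI // leqn0.
(* By freeness f P and g P, both of dimension dim P, meet in dimension less than dim P; this
   intersection contains a copy of Z. *)
have sub : (g @: (i @: Z) <= f @: P :&: g @: P)%VS.
  rewrite subv_cap [X in _ && X]limgS ?addvSl // andbT.
  apply/subvP => _ /memv_imgP [_ /memv_imgP [z zZ ->] ->].
  have -> : g (i z) = f (i' z).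
    rewrite !comp_lfunE limg_lfunVK // memv_preim iE; exact: subvsP.
  by rewrite memv_img // (subvP (addvSr _ _)) // memv_img.
have := dimvS sub; have := dimv_sum_cap (f @: P) (g @: P); have := fg P nzP.
rewrite !dimI //; lia.
Qed.

(** Induction on dim W through the twist by O(-1): a frame found in [W], the target of the twist,
    lifts to [V] with each chain one vector longer. The bound on dim V limits the number of chains
    to two. *)
Lemma pencil_free_frame (W V : vectType k) (f g : 'Hom(W, V)) :
    pencil_free f g -> (\dim {:V} <= \dim {:W} + 2)%N ->
  exists a b x y w w', (b <= a)%N /\ chain_frame f g a b x y w w'.
Proof.
have [n] := ubnP (\dim {:W}); elim: n W V f g => // n IHn W V f g lt_n fg leV.
have [W0|W_gt0] := posnP (\dim {:W}).
  by apply: chain_frame_point => //; rewrite W0 in leV.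
have [f_inj g_inj] := pencil_free_inj fg.
pose H := (limg f + limg g)%VS; pose K := (g @^-1: limg f)%VS.
pose i : 'Hom(subvs_of K, W) := linfun vsval.
have iE u : i u = vsval u by rewrite lfunE.
have dimK : (\dim {:subvs_of K} + \dim H)%N = (\dim {:W} + \dim {:W})%N.
  have gK : (g @: K = limg f :&: limg g)%VS.
    by rewrite /K -lpreim_cap_limg lpreimK // capvSr.
  have <- : \dim (g @: K) = \dim {:subvs_of K}.
    by rewrite limg_dim_eq ?g_inj ?capv0 // dimvf.
  by rewrite gK addnC dimv_sum_cap !limg_dim_eq ?f_inj ?g_inj ?capv0.
have ltH : (\dim {:W} < \dim H)%N by apply: fg; rewrite -dimv_eq0 -lt0n.
have leH : (\dim H <= \dim {:V})%N by rewrite dimvS ?subvf.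
have ltK : (\dim {:subvs_of K} < n)%N by lia.
have leWK : (\dim {:W} <= \dim {:subvs_of K} + 2)%N by lia.
have [a [b [w [w' [u [u' [le_ba fr]]]]]]] := IHn _ _ _ _ ltK (pencil_free_shift fg iE) leWK.
have [cl cr sp _ dW dK] := fr.
(* A link of a chain in [W] says f (w j) = g (w j.+1), so the images of the chain under [f] and [g]
   overlap and form a single chain in [V]. *)
have step a1 w1 u1 : chain i (f^-1 \o (g \o i)) a1.-1 w1 u1 ->
    forall j, (j.+1 < a1)%N -> f (w1 j) = g (w1 j.+1).
  move=> c1 j lt_j; have [|<- <-] := c1 j; first by case: a1 lt_j {c1}.
  rewrite !comp_lfunE limg_lfunVK // memv_preim iE; exact: subvsP.
pose lift (w1 : nat -> W) j := if j is j'.+1 then f (w1 j') else g (w1 0%N).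
have lift_chain a1 w1 u1 : chain i (f^-1 \o (g \o i)) a1.-1 w1 u1 ->
    chain f g a1 (lift w1) w1.
  by move=> c1 [|j] lt_j; split=> //=; rewrite (step _ _ _ c1).
have HsubS (S : {vspace V}) : (forall j, (j < a.+1)%N -> lift w j \in S) ->
    (forall j, (j < b.+1)%N -> (0 < b)%N -> lift w' j \in S) -> (H <= S)%VS.
  move=> xS yS; rewrite subv_add.
  have preim_full (h : 'Hom(W, V)) : (forall j, (j < a)%N -> h (w j) \in S) ->
      (forall j, (j < b)%N -> h (w' j) \in S) -> (limg h <= S)%VS.
    move=> hw hw'; apply/subvP => _ /memv_imgP [v _ ->].
    by rewrite memv_preim (sp (h @^-1: S)%VS) ?memvf // => j lt_j; rewrite -memv_preim; auto.
  apply/andP; split; apply: preim_full => j lt_j.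
  - exact: (xS j.+1).
  - by apply: (yS j.+1) => //; apply: leq_ltn_trans lt_j.
  - by have [_ ->] := lift_chain _ _ _ cl j lt_j; apply: xS; apply: ltnW.
  have [_ ->] := lift_chain _ _ _ cr j lt_j.
  by apply: yS; [apply: ltnW | apply: leq_ltn_trans lt_j].
(* With two chains in [W], dim H = dim W + 2 and thus H = V. With one chain, dim H = dim W + 1; if H
   is not V, a vector [z] outside H forms a second chain of length one with nothing above it in
   [W]. *)
have [b0|b_gt0] := posnP b; last first.
  exists a.+1, b.+1, (lift w), (lift w'), w, w'; split; first by rewrite ltnS.
  split=> //; try exact: lift_chain cl; try exact: lift_chain cr; try lia.
  move=> S xS yS; apply/eqP; rewrite eqEdim subvf /=.
  have /dimvS : (H <= S)%VS by apply: HsubS => // j lt_j _; apply: yS.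
  by lia.
pose z := vpick H^C%VS.
exists a.+1, (H != fullv), (lift w), (fun=> z), w, (fun=> 0); split.
  by case: (H != _).
have dimH : \dim H = (\dim {:W}).+1 by move: dK; rewrite b0 /=; lia.
have eqH : \dim {:V} = (\dim H + (H != fullv))%N.
  have [->|neH] := eqVneq H fullv; first by rewrite addn0.
  have : (\dim H < \dim {:V})%N.
    by rewrite ltn_neqAle leH andbT (dimv_leqif_eq (subvf H)).
  by move=> /= ?; lia.
split=> //.
- exact: lift_chain cl.
- by move=> j; case: (H != _).
- move=> S xS yS; have HS : (H <= S)%VS by apply: HsubS => // j _; rewrite b0.
  have [eqHf|neH] := eqVneq H fullv.
    by apply/eqP; rewrite eqEsubv subvf -eqHf.
  apply/eqP; rewrite eqEdim subvf /= eqH neH addn1.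
  have nzz : z != 0.
    rewrite vpick0 -dimv_eq0 dimv_compl eqH neH; lia.
  have zH : z \notin H.
    apply: contra nzz => zH; have : z \in (H :&: H^C)%VS by rewrite memv_cap zH memv_pick.
    by rewrite capv_compl memv0.
  rewrite ltn_neqAle dimvS // andbT (dimv_leqif_eq HS).
  by apply: contra zH => /eqP ->; apply: (yS 0%N); rewrite neH.
- move=> S xS _; apply: sp => [|j]; [exact: xS | by rewrite b0].
- by rewrite eqH dimH dW b0 addn0 addSn.
by rewrite dW b0; case: (H != _).
Qed.

End ChainFrames.

(** * Normalizing three lines by automorphisms of a pair of chains *)

Section ThreeLines.

Variable k : fieldType.

(** Three distinct points of the projective line can be moved to [1:0], [0:1], [1:1]. The rows (p,
    q) and (r, s) are the new basis: two independent vectors among the three, rescaled if the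
    remaining one involves both, or a completion of one vector if all are parallel. *)
Lemma three_lines (z1 z2 z3 : k * k) : z1 != 0 -> z2 != 0 -> z3 != 0 ->
  exists p q r s, p * s - q * r != 0 /\
    forall z, z \in [:: z1; z2; z3] -> exists c (al be : bool),
      [/\ c != 0, z.1 = c * (al%:R * p + be%:R * r)
        & z.2 = c * (al%:R * q + be%:R * s)].
Proof.
case: z1 z2 z3 => [p1 q1] [p2 q2] [p3 q3] nz1 nz2 nz3.
have [d0|nz12] := eqVneq (p1 * q2 - q1 * p2) 0; last first.
  pose A := (p3 * q2 - q3 * p2) / (p1 * q2 - q1 * p2).
  pose B := (p1 * q3 - q1 * p3) / (p1 * q2 - q1 * p2).
  have p3E : p3 = A * p1 + B * p2 by rewrite /A /B; field.
  have q3E : q3 = A * q1 + B * q2 by rewrite /A /B; field.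
  move: A B p3E q3E => A B p3E q3E.
  have [A0|nzA] := eqVneq A 0.
    exists p1, q1, p2, q2; split=> // z; rewrite !inE => /or3P[] /eqP -> /=.
    - by exists 1, true, false; rewrite oner_eq0; split=> //=; ring.
    - by exists 1, false, true; rewrite oner_eq0; split=> //=; ring.
    exists B, false, true; split=> /=; [|rewrite p3E A0; ring|rewrite q3E A0; ring].
    by apply: contra nz3 => /eqP B0; rewrite p3E q3E A0 B0 !mul0r addr0.
  have [B0|nzB] := eqVneq B 0.
    exists p1, q1, p2, q2; split=> // z; rewrite !inE => /or3P[] /eqP -> /=.
    - by exists 1, true, false; rewrite oner_eq0; split=> //=; ring.
    - by exists 1, false, true; rewrite oner_eq0; split=> //=; ring.
    by exists A, true, false; split=> //=; [rewrite p3E B0; ring|rewrite q3E B0; ring].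
  exists (A * p1), (A * q1), (B * p2), (B * q2); split.
    rewrite (_ : _ - _ = A * B * (p1 * q2 - q1 * p2)); last by ring.
    by rewrite !mulf_neq0.
  move=> z; rewrite !inE => /or3P[] /eqP -> /=.
  - by exists A^-1, true, false; rewrite invr_eq0; split=> //=; field.
  - by exists B^-1, false, true; rewrite invr_eq0; split=> //=; field.
  by exists 1, true, true; rewrite oner_eq0; split=> //=; [rewrite p3E; ring|rewrite q3E; ring].
have par (r s : k) : (r, s) != 0 -> p1 * s - q1 * r = 0 ->
  exists c, [/\ c != 0, r = c * p1 & s = c * q1].
  move=> nz d1; have [p10|nzp] := eqVneq p1 0; last first.
    exists (r / p1); split; [|by field|].
      rewrite mulf_neq0 ?invr_eq0 //; apply: contra nz => /eqP r0.
      move/eqP: d1; rewrite r0 mulr0 subr0 mulf_eq0 (negPf nzp) /= => /eqP ->.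
      by rewrite eqxx.
    by apply: (mulfI nzp); move/eqP: d1; rewrite subr_eq0 => /eqP ->; field.
  have nzq : q1 != 0 by apply: contra nz1 => /eqP ->; rewrite p10.
  move/eqP: d1; rewrite p10 mul0r sub0r oppr_eq0 mulf_eq0 (negPf nzq) /= => /eqP r0.
  exists (s / q1); split; [|by rewrite mulr0|by field].
  rewrite mulf_neq0 ?invr_eq0 //; apply: contra nz => /eqP s0.
  by rewrite r0 s0 eqxx.
have [c2 [nzc2 p2E q2E]] := par p2 q2 nz2 d0.
have [d0'|nz13] := eqVneq (p1 * q3 - q1 * p3) 0; last first.
  exists p1, q1, p3, q3; split=> // z; rewrite !inE => /or3P[] /eqP -> /=.
  - by exists 1, true, false; rewrite oner_eq0; split=> //=; ring.
  - by exists c2, true, false; split=> //=; rewrite ?p2E ?q2E; ring.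
  by exists 1, false, true; rewrite oner_eq0; split=> //=; ring.
have [c3 [nzc3 p3E q3E]] := par p3 q3 nz3 d0'.
have [r [s nzd]] : exists r s, p1 * s - q1 * r != 0.
  have [p10|nzp] := eqVneq p1 0; last by exists 0, 1; rewrite mulr1 mulr0 subr0.
  exists 1, 0; rewrite mulr1 mulr0 sub0r oppr_eq0.
  by apply: contra nz1 => /eqP ->; rewrite p10.
exists p1, q1, r, s; split=> // z; rewrite !inE => /or3P[] /eqP -> /=.
- by exists 1, true, false; rewrite oner_eq0; split=> //=; ring.
- by exists c2, true, false; split=> //=; rewrite ?p2E ?q2E; ring.
by exists c3, true, false; split=> //=; rewrite ?p3E ?q3E; ring.
Qed.

End ThreeLines.

Section FrameChange.

Variables (k : fieldType) (W V : vectType k) (f g : 'Hom(W, V)).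

Section Ends.

Variables (a b : nat) (x y : nat -> V) (w w' : nat -> W).
Hypothesis fr : chain_frame f g a.+1 b.+1 x y w w'.

(** Modulo the image of f + c g one has x_(j+1) = - c x_j, so the starts of the chains span the
    fibre. The values c = 0 and c = 1 serve the first and the third arm. *)
Lemma frame_lower (h : 'Hom(W, V)) (c : k) u :
    (forall v, h v = f v + c *: g v) ->
  exists z : k * k, u - (z.1 *: x 0%N + z.2 *: y 0%N) \in limg h.
Proof.
move=> hE; have [cx cy sp _ _ _] := fr.
pose S := (limg h + (<[x 0%N]> + <[y 0%N]>))%VS.
have chain_sub n z v : chain f g n z v -> z 0%N \in S ->
    forall j, (j < n.+1)%N -> z j \in S.
  move=> cz z0 j; elim: j => // j IHj; rewrite ltnS => lt_j.
  have [<- gE] := cz j lt_j; have zj := IHj (ltnW lt_j).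
  rewrite -[f _](addrK (c *: g (v j))) -hE gE memvB ?memvZ //.
  by rewrite (subvP (addvSl _ _)) // memv_img ?memvf.
have SF : S = fullv.
  apply: sp => j lt_j.
    apply: (chain_sub _ _ _ cx) => //; rewrite (subvP (addvSr _ _)) //.
    by rewrite (subvP (addvSl _ _)) ?memv_line.
  apply: (chain_sub _ _ _ cy) => //; rewrite (subvP (addvSr _ _)) //.
  by rewrite (subvP (addvSr _ _)) ?memv_line.
have : u \in S by rewrite SF memvf.
case/memv_addP => v hv [_ /memv_addP [_ /vlineP [al ->] [_ /vlineP [be ->] ->]] ->].
by exists (al, be); rewrite addrK.
Qed.

(** Modulo the image of [g] every x_j except the last vanishes, so the ends of the chains span this
    fibre. *)
Lemma frame_upper u :
  exists z : k * k, u - (z.1 *: x a + z.2 *: y b) \in limg g.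
Proof.
have [cx cy sp _ _ _] := fr.
pose S := (limg g + (<[x a]> + <[y b]>))%VS.
have chain_sub n z v : chain f g n z v -> z n \in S ->
    forall j, (j < n.+1)%N -> z j \in S.
  move=> cz zn j; rewrite ltnS leq_eqVlt => /predU1P [-> //|lt_j].
  have [_ <-] := cz j lt_j.
  by rewrite (subvP (addvSl _ _)) // memv_img ?memvf.
have SF : S = fullv.
  apply: sp => j lt_j.
    apply: (chain_sub _ _ _ cx) => //; rewrite (subvP (addvSr _ _)) //.
    by rewrite (subvP (addvSl _ _)) ?memv_line.
  apply: (chain_sub _ _ _ cy) => //; rewrite (subvP (addvSr _ _)) //.
  by rewrite (subvP (addvSr _ _)) ?memv_line.
have : u \in S by rewrite SF memvf.
case/memv_addP => v hv [_ /memv_addP [_ /vlineP [al ->] [_ /vlineP [be ->] ->]] ->].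
by exists (al, be); rewrite addrK.
Qed.

(** Homomorphisms from O(b) to O(a) are forms of degree a - b; [r0] and [r1] are the coefficients of
    the two extreme monomials. If b < a, they act independently on the fibres of the first and the
    second arm. *)
Lemma frame_shear (r0 r1 mu : k) : mu != 0 -> (b <= a)%N ->
  chain_frame f g a.+1 b.+1 x
    (fun j => mu *: (y j + r0 *: x j + r1 *: x (j + (a - b))%N))
    w (fun j => mu *: (w' j + r0 *: w j + r1 *: w (j + (a - b))%N)).
Proof.
move=> nz_mu le_ba; have [cx cy sp spW dV dW] := fr.
split=> //.
- move=> j lt_j; have [<- <-] := cy j lt_j.
  have lt_ja : (j + (a - b) < a)%N by move: lt_j le_ba => /=; lia.
  have [f1 g1] := cx j (leq_ltn_trans (leq_addr _ _) lt_ja).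
  have [f2 g2] := cx _ lt_ja.
  rewrite addSn !linearZ !linearD !linearZ /= f1 g1 f2 g2.
  by split; rewrite !scalerDr !scalerA ![mu * _]mulrC.
- move=> S xS yS; apply: sp => // j lt_j.
  have := yS j lt_j; rewrite rpredZeq (negPf nz_mu) /= !rpredDr ?memvZ ?xS //; lia.
move=> S wS vS; apply: spW => // j lt_j.
have := vS j lt_j; rewrite rpredZeq (negPf nz_mu) /= !rpredDr ?memvZ ?wS //=; lia.
Qed.

Lemma frame_mix (p q r s : k) : p * s - q * r != 0 -> a = b ->
  chain_frame f g a.+1 b.+1
    (fun j => p *: x j + q *: y j) (fun j => r *: x j + s *: y j)
    (fun j => p *: w j + q *: w' j) (fun j => r *: w j + s *: w' j).
Proof.
move=> nzd ab; have [cx cy sp spW dV dW] := fr.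
have inv_comb (U : vectType k) (S : {vspace U}) (u v : U) :
    p *: u + q *: v \in S -> r *: u + s *: v \in S -> u \in S /\ v \in S.
  move=> pS rS; split.
    have : s *: (p *: u + q *: v) - q *: (r *: u + s *: v) \in S by rewrite memvB ?memvZ.
    rewrite !scalerDr !scalerA opprD addrACA [s * q]mulrC subrr addr0 -scalerBl.
    by rewrite rpredZeq [s * p]mulrC (negPf nzd).
  have : p *: (r *: u + s *: v) - r *: (p *: u + q *: v) \in S by rewrite memvB ?memvZ.
  rewrite !scalerDr !scalerA opprD addrACA [p * r]mulrC subrr add0r -scalerBl.
  by rewrite rpredZeq [r * q]mulrC (negPf nzd).
have mix_chain c d : chain f g a (fun j => c *: x j + d *: y j) (fun j => c *: w j + d *: w' j).
  move=> j lt_j; have [<- <-] := cx j lt_j.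
  have [<- <-] := cy j (leq_trans lt_j (eq_leq ab)).
  by rewrite !linearD !linearZ.
split=> //; rewrite /= -?ab.
- exact: mix_chain.
- move=> S xS yS; apply: sp; rewrite -?ab => j lt_j.
    by have [] := inv_comb _ _ _ _ (xS j lt_j) (yS j lt_j).
  by have [] := inv_comb _ _ _ _ (xS j lt_j) (yS j lt_j).
move=> S wS vS; apply: spW; rewrite -?ab => j lt_j.
  by have [] := inv_comb _ _ _ _ (wS j lt_j) (vS j lt_j).
by have [] := inv_comb _ _ _ _ (wS j lt_j) (vS j lt_j).
Qed.

End Ends.

Definition unit_comb (I : {vspace V}) (x y u : V) :=
  exists c (al be : bool), c != 0 /\ u - c *: (al%:R *: x + be%:R *: y) \in I.

Definition on_axis (I : {vspace V}) (x y u : V) :=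
  exists c, c != 0 /\ (u - c *: x \in I \/ u - c *: y \in I).

Lemma on_axis_unit I x y u : on_axis I x y u -> unit_comb I x y u.
Proof.
case=> c [nzc [xI|yI]]; [exists c, true, false | exists c, false, true].
  by rewrite scale1r scale0r addr0.
by rewrite scale1r scale0r add0r.
Qed.

Lemma on_axis_scale I x y u mu :
  mu != 0 -> on_axis I x y u -> on_axis I x (mu *: y) u.
Proof.
move=> nz_mu [c [nzc [xI|yI]]]; first by exists c; split=> //; left.
exists (c / mu); rewrite mulf_neq0 ?invr_eq0 //; split=> //; right.
by rewrite scalerA divfK.
Qed.

(** The ratio of the coordinates moves the line of [u] to the second axis, unless it is already the
    first. The free [v] absorbs the part of a shear that is invisible modulo [I]. *)
Lemma on_axis_shear (I : {vspace V}) (x y u : V) (z : k * k) r : u \notin I ->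
    u - (z.1 *: x + z.2 *: y) \in I -> (z.2 != 0 -> r = z.1 / z.2) ->
  forall v, v \in I -> on_axis I x (y + r *: x + v) u.
Proof.
move=> uI zI rE v vI; have [z20|nz2] := eqVneq z.2 0.
  exists z.1; move: zI; rewrite z20 scale0r addr0 => zI; split; last by left.
  by apply: contra uI => /eqP z10; rewrite z10 scale0r subr0 in zI.
exists z.2; split=> //; right; rewrite rE //.
rewrite !scalerDr scalerA mulrCA divff // mulr1 opprD addrA [z.2 *: y + _]addrC.
by rewrite memvB ?memvZ.
Qed.

(** If a = b, the full linear group acts on the pair of chains and [three_lines] applies. If b < a,
    two shears put the first two lines on axes, and scaling the second chain, which preserves the
    axes, equalizes the coordinates of the third line. *)
Lemma adapted_frame a b x y w w' (h : 'Hom(W, V)) u1 u2 u3 :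
    chain_frame f g a.+1 b.+1 x y w w' -> (b <= a)%N ->
    (forall v, h v = f v + g v) ->
    u1 \notin limg f -> u2 \notin limg g -> u3 \notin limg h ->
  exists x y w w', [/\ chain_frame f g a.+1 b.+1 x y w w',
    unit_comb (limg f) (x 0%N) (y 0%N) u1,
    unit_comb (limg g) (x a) (y b) u2 &
    unit_comb (limg h) (x 0%N) (y 0%N) u3].
Proof.
move=> fr le_ba hE u1f u2g u3h.
have hE' v : h v = f v + 1 *: g v by rewrite scale1r.
have fE v : f v = f v + 0 *: g v by rewrite scale0r addr0.
have [z1 z1P] := frame_lower fr u1 fE.
have [z2 z2P] := frame_upper fr u2.
move: le_ba; rewrite leq_eqVlt => /predU1P [ab|lt_ba].
  have [z3 z3P] := frame_lower fr u3 hE'.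
  have nz (I : {vspace V}) u (z : k * k) p q :
      u \notin I -> u - (z.1 *: p + z.2 *: q) \in I -> z != 0.
    move=> uI zI; apply: contra uI => /eqP z0.
    by move: zI; rewrite z0 !scale0r addr0 subr0.
  have [p [q [r [s [nzd zP]]]]] :=
    three_lines (nz _ _ _ _ _ u1f z1P) (nz _ _ _ _ _ u2g z2P) (nz _ _ _ _ _ u3h z3P).
  have unitP (I : {vspace V}) u z p' q' : z \in [:: z1; z2; z3] ->
      u - (z.1 *: p' + z.2 *: q') \in I ->
      unit_comb I (p *: p' + q *: q') (r *: p' + s *: q') u.
    move=> /zP [c [al [be [nzc -> ->]]]] zI; exists c, al, be; split=> //.
    suff -> : c *: (al%:R *: (p *: p' + q *: q') + be%:R *: (r *: p' + s *: q')) =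
      (c * (al%:R * p + be%:R * r)) *: p' + (c * (al%:R * q + be%:R * s)) *: q' by [].
    by rewrite !scalerDr !scalerA !mulrDr !scalerDl !mulrA addrACA.
  have fr' := frame_mix fr nzd (esym ab).
  do 4!eexists; split; first exact: fr'.
  - by apply: (unitP _ _ z1) => //; rewrite !inE eqxx.
  - by rewrite ab in z2P *; apply: (unitP _ _ z2) => //; rewrite !inE eqxx orbT.
  by apply: (unitP _ _ z3) => //; rewrite !inE eqxx !orbT.
have [cx _ _ _ _ _] := fr.
(* A zero denominator is harmless: the line is then the first axis, which every shear fixes. *)
pose r0 := z1.1 / z1.2; pose r1 := z2.1 / z2.2.
have fr1 := frame_shear fr r0 r1 (oner_neq0 k) (ltnW lt_ba).
move: fr1; set y1 := (fun j => _ : V); set w1 := (fun j => _ : W) => fr1.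
have ax1 : on_axis (limg f) (x 0%N) (y1 0%N) u1.
  rewrite /y1 scale1r; apply: on_axis_shear z1P _ _ _ => //.
  rewrite memvZ // add0n -(subnSK lt_ba); have [|<- _] := cx (a - b.+1)%N.
    by rewrite /=; lia.
  by rewrite memv_img ?memvf.
have ax2 : on_axis (limg g) (x a) (y1 b) u2.
  rewrite /y1 scale1r subnKC ?(ltnW lt_ba) // addrAC.
  apply: on_axis_shear z2P _ _ _ => //.
  by rewrite memvZ //; have [_ <-] := cx b lt_ba; rewrite memv_img ?memvf.
have [z3 z3P] := frame_lower fr1 u3 hE'.
have [nz|] := boolP ((z3.1 != 0) && (z3.2 != 0)); last first.
  rewrite negb_and !negbK => z30; exists x, y1, w, w1; split=> //.
  - exact: on_axis_unit.
  - exact: on_axis_unit.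
  apply: on_axis_unit.
  have [E1|nz1] := eqVneq z3.1 0.
    exists z3.2; move: z3P; rewrite E1 scale0r add0r => z3P; split; last by right.
    by apply: contra u3h => /eqP E2; rewrite E2 scale0r subr0 in z3P.
  move: z30; rewrite (negPf nz1) => /eqP E2; exists z3.1; split=> //; left.
  by move: z3P; rewrite E2 scale0r addr0.
have /andP [nz1 nz2] := nz; pose mu := z3.2 / z3.1.
have nz_mu : mu != 0 by rewrite mulf_neq0 ?invr_eq0.
have fr2 := frame_shear fr1 0 0 nz_mu (ltnW lt_ba).
do 4!eexists; split; first exact: fr2; rewrite /= !scale0r !addr0.
- exact/on_axis_unit/on_axis_scale.
- exact/on_axis_unit/on_axis_scale.
exists z3.1, true, true; split=> //.
by rewrite !scale1r scalerDr scalerA mulrCA divff // mulr1.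
Qed.

End FrameChange.

(** * Bases with coordinates 0, 1, -1 *)

Section SignCombinations.

Variable k : fieldType.
Implicit Types U : vectType k.

(** Coefficients are indexed by nat, independently of [s], so they carry over along [map];
    coordinates enter only once freeness is known. *)
Definition sign_comb U (s : seq U) (z : U) :=
  exists2 c : nat -> k, forall j, c j \in [:: 0; 1; -1]
                      & z = \sum_(j < size s) c j *: s`_j.

Lemma sign_comb_nth2 U (s : seq U) i j (al be : bool) :
    (i < size s)%N -> (j < size s)%N -> i != j ->
  sign_comb s (al%:R *: s`_i + be%:R *: s`_j).
Proof.
move=> lt_i lt_j ne_ij.
exists (fun l => if l == i then al%:R else if l == j then be%:R else 0).
  by move=> l; rewrite !inE; case: ifP => _; [case: al|case: ifP => _; [case: be|]];
    rewrite ?eqxx ?orbT.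
rewrite (bigD1 (Ordinal lt_i)) //= eqxx; congr (_ + _).
rewrite (bigD1 (Ordinal lt_j)) /= ?eqxx; last by rewrite eq_sym.
rewrite [j == i]eq_sym (negPf ne_ij) big1 ?addr0 // => l /andP [ne_i ne_j].
rewrite -!val_eqE /= in ne_i ne_j.
by rewrite (negPf ne_i) (negPf ne_j) scale0r.
Qed.

Lemma sign_comb_mem U (s : seq U) z : z \in s -> sign_comb s z.
Proof.
case/(nthP 0) => i lt_i <-.
exists (fun j => (j == i)%:R).
  by move=> j; case: (j == i); rewrite !inE eqxx ?orbT.
rewrite (bigD1 (Ordinal lt_i)) //= eqxx scale1r big1 ?addr0 // => j.
by rewrite -val_eqE /= => /negPf ->; rewrite scale0r.
Qed.

Lemma sign_comb_map U U' (h : 'Hom(U, U')) (s : seq U) (s' : seq U') z :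
  lker h = 0%VS -> map h s = s' -> sign_comb s' (h z) -> sign_comb s z.
Proof.
move=> h0 <- [c cP hz]; exists c => //.
have /lker0P h_inj : lker h == 0%VS by apply/eqP.
apply: h_inj; rewrite hz size_map linear_sum; apply: eq_bigr => j _.
by rewrite linearZ (nth_map 0).
Qed.

Lemma sign_comb_coord U n (s : n.-tuple U) z j :
  free s -> sign_comb s z -> coord s j z \in [:: 0; 1; -1].
Proof. by move=> s_free [c cP ->]; rewrite size_tuple coord_sum_free. Qed.

End SignCombinations.

Section AdaptedBases.

Variables (k : fieldType) (W V : vectType k) (f : 'I_3 -> 'Hom(W, V)).

Lemma unit_comb_line (I : {vspace V}) (x y u : V) : unit_comb I x y u ->
  exists al be : bool, (I + <[u]> = I + <[al%:R *: x + be%:R *: y]>)%VS.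
Proof.
case=> c [al [be [nzc uI]]]; exists al, be.
move: (al%:R *: x + be%:R *: y) uI => v uI; apply/eqP; rewrite eqEsubv !subv_add !addvSl /= -!memvE.
apply/andP; split.
  by rewrite -[u](subrK (c *: v)) memv_add ?memvZ ?memv_line.
rewrite -[X in X \in _]scale1r -(mulVf nzc) -scalerA memvZ //.
by rewrite -[c *: v](subKr u) addrC memv_add ?memv_line // memvN.
Qed.

Lemma adapted_bases (u : 'I_3 -> V) :
    pencil_free (f arm0) (f arm1) -> (forall v, f arm2 v = f arm0 v + f arm1 v) ->
    \dim {:V} = (\dim {:W} + 2)%N -> (forall i, u i \notin limg (f i)) ->
  exists (s : seq V) (r : seq W) (u' : 'I_3 -> V),
    [/\ basis_of fullv s, basis_of fullv r,
        forall i e, e \in r -> sign_comb s (f i e),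
        forall i, sign_comb s (u' i) &
        forall i, (limg (f i) + <[u i]> = limg (f i) + <[u' i]>)%VS].
Proof.
move=> free_f f2E dimV uf; have le_dim : (\dim {:V} <= \dim {:W} + 2)%N by rewrite dimV.
have [a [b [x0 [y0 [w0 [w0' [le_ba fr0]]]]]]] := pencil_free_frame free_f le_dim.
(* An empty chain contributes 0 to both dimensions and a nonempty one contributes 1 to their
   difference, so a difference of two requires both chains. *)
have [] : (0 < a)%N /\ (0 < b)%N by have [_ _ _ _ dV dW] := fr0; lia.
case: a b le_ba fr0 => [|a] [|b] //; rewrite ltnS => le_ba fr0 _ _.
have [x [y [w [w' [fr un0 un1 un2]]]]] :=
  adapted_frame fr0 le_ba f2E (uf arm0) (uf arm1) (uf arm2).
have [al0 [be0 line0]] := unit_comb_line un0.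
have [al1 [be1 line1]] := unit_comb_line un1.
have [al2 [be2 line2]] := unit_comb_line un2.
have [cx cy sp spW dV dW] := fr; rewrite /= in cx cy spW dW.
pose s := mkseq x a.+1 ++ mkseq y b.+1; pose r := mkseq w a ++ mkseq w' b.
have size_s : size s = (a.+1 + b.+1)%N by rewrite size_cat !size_mkseq.
have size_r : size r = (a + b)%N by rewrite size_cat !size_mkseq.
have s_x j : (j < a.+1)%N -> s`_j = x j.
  by move=> lt_j; rewrite nth_cat size_mkseq lt_j nth_mkseq.
have s_y j : (j < b.+1)%N -> s`_(a.+1 + j) = y j.
  by move=> lt_j; rewrite nth_cat size_mkseq ltnNge leq_addr /= addKn nth_mkseq.
have mem_mk (U : vectType k) n (z : nat -> U) j : (j < n)%N -> z j \in mkseq z n.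
  by move=> lt_j; apply: map_f; rewrite mem_iota.
have xy_comb i j (al be : bool) : (i < a.+1)%N -> (j < b.+1)%N ->
    sign_comb s (al%:R *: x i + be%:R *: y j).
  move=> lt_i lt_j; rewrite -s_x // -s_y //; apply: sign_comb_nth2; lia.
have xx_comb j (al be : bool) : (j < a)%N -> sign_comb s (al%:R *: x j.+1 + be%:R *: x j).
  by move=> lt_j; rewrite -s_x // -s_x 1?ltnW //; apply: sign_comb_nth2; lia.
have yy_comb j (al be : bool) : (j < b)%N -> sign_comb s (al%:R *: y j.+1 + be%:R *: y j).
  by move=> lt_j; rewrite -s_y // -s_y 1?ltnW //; apply: sign_comb_nth2; lia.
pose u' (i : 'I_3) := if i == arm0 then al0%:R *: x 0%N + be0%:R *: y 0%N
  else if i == arm1 then al1%:R *: x a + be1%:R *: y b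
  else al2%:R *: x 0%N + be2%:R *: y 0%N.
exists s, r, u'; split.
- rewrite basisEdim size_s dV leqnn andbT; have -> // : <<s>>%VS = fullv.
  by apply: sp => j lt_j; apply: memv_span; rewrite mem_cat mem_mk ?orbT.
- rewrite basisEdim size_r dW leqnn andbT; have -> // : <<r>>%VS = fullv.
  by apply: spW => j lt_j; apply: memv_span; rewrite mem_cat mem_mk ?orbT.
- move=> i e; rewrite mem_cat => /orP [] /mapP [j]; rewrite mem_iota add0n => /= lt_j ->.
    have [E0 E1] := cx j lt_j; move: i; apply: arms_ind; rewrite ?f2E ?E0 ?E1.
    + by have := xx_comb j true false lt_j; rewrite scale1r scale0r addr0.
    + by have := xx_comb j false true lt_j; rewrite scale1r scale0r add0r.
    by have := xx_comb j true true lt_j; rewrite !scale1r.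
  have [E0 E1] := cy j lt_j; move: i; apply: arms_ind; rewrite ?f2E ?E0 ?E1.
  + by have := yy_comb j true false lt_j; rewrite scale1r scale0r addr0.
  + by have := yy_comb j false true lt_j; rewrite scale1r scale0r add0r.
  by have := yy_comb j true true lt_j; rewrite !scale1r.
- by apply: arms_ind; apply: xy_comb.
by apply: arms_ind.
Qed.

End AdaptedBases.

Lemma described_by_sign_comb (k : fieldType) (t : nat) (L : canonical_data k t)
    (M : canonical_module L) (B : forall v, seq (M v)) :
    (forall v, basis_of fullv (B v)) ->
    (forall v w (a : arrow v w) z, z \in B w -> sign_comb (B v) (action M a z)) ->
  described_by_01m1 M.
Proof.
move=> basisB signB.
have sizeB v : size (B v) == \dim {:M v}.
  by apply/eqP; rewrite -(size_basis (X := in_tuple (B v)) (basisB v)).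
exists (fun v => Tuple (sizeB v)); split=> // v w a i j.
rewrite mxE /= passmx.vecof_delta mxE; apply: sign_comb_coord.
  exact: basis_free (basisB v).
by apply: signB; apply: mem_nth; rewrite (eqP (sizeB w)).
Qed.

(** * Bases of a torsion-free module of rank two *)

Section TorsionFreeModules.

Variables (k : fieldType) (L : canonical_data k 3) (M : canonical_module L).

Let W := M (vc L).
Let V := M (vzero L).
Let f (i : 'I_3) : 'Hom(W, V) := arm_map (action M) i.
Let n := \dim {:W}.

Hypothesis free_f : pencil_free (f arm0) (f arm1).
Hypothesis iota_inj : forall v, v <> vc L -> lker (iota M v) = 0%VS.
Hypothesis dimV : \dim {:V} = (n + 2)%N.

Let f_inj i : lker (f i) = 0%VS.
Proof.
have [f0 f1] := pencil_free_inj free_f.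
have free2 : pencil_free (f arm0) (f arm2).
  move=> X nzX; apply: leq_trans (free_f nzX) (dimvS _).
  rewrite subv_add addvSl /=; apply/subvP => _ /memv_imgP [x xX ->].
  by rewrite -[f arm1 x](addKr (f arm0 x)) -arm2E -linearN memv_add ?memv_img ?memvN.
by move: i; apply: arms_ind => //; have [] := pencil_free_inj free2.
Qed.

Let dim_img (U1 U2 : vectType k) (h : 'Hom(U1, U2)) :
  lker h = 0%VS -> \dim (limg h) = \dim {:U1}.
Proof. by move=> h0; rewrite limg_dim_eq // h0 capv0. Qed.

Let arm_sub i (j : 'I_(weight L i).-1) : (limg (f i) <= limg (iota M (vmid j)))%VS.
Proof.
apply/subvP => _ /memv_imgP [x _ ->].
by rewrite /f -(iota_kappa j) memv_img ?memvf.
Qed.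

Let dim_inner i (j : 'I_(weight L i).-1) :
  (n <= \dim {:M (vmid j)} <= n + 2)%N.
Proof.
rewrite -(dim_img (@iota_inj (vmid j) ltac:(done))) -[n in (n <= _)%N](dim_img (f_inj i)).
by rewrite dimvS ?arm_sub // -dimV dimvS ?subvf.
Qed.

Let arm_nested i (j j' : 'I_(weight L i).-1) : (j <= j')%N ->
  (limg (iota M (vmid j')) <= limg (iota M (vmid j)))%VS.
Proof.
move=> /subnKC; move: (j' - j)%N => d; elim: d j' => [|d IHd] j' jE.
  by have -> : j = j' by apply: val_inj; rewrite /= -jE addn0.
have lt_d : (j + d < (weight L i).-1)%N.
  by apply: leq_ltn_trans (ltn_ord j'); rewrite -jE leq_add2l.
apply: subv_trans (IHd (Ordinal lt_d) erefl).
have j'E : j' = (Ordinal lt_d).+1 :> nat by rewrite -jE addnS.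
apply/subvP => _ /memv_imgP [x _ ->].
by rewrite (iota_mid j'E) memv_img ?memvf.
Qed.

(** The images of the inner spaces of an arm form a decreasing flag between V and f_i W, of
    codimension two; those of dimension n + 1 are nested and hence all equal. If there are none, any
    vector outside f_i W will do. *)
Let arm_line i : exists u, u \notin limg (f i) /\
  forall j : 'I_(weight L i).-1, \dim {:M (vmid j)} = n.+1 ->
    (limg (iota M (vmid j)) = limg (f i) + <[u]>)%VS.
Proof.
have dim_iota (j : 'I_(weight L i).-1) :
    \dim (limg (iota M (vmid j))) = \dim {:M (vmid j)} by apply/dim_img/iota_inj.
have [j0 /eqP dj0|no_j] := pickP (fun j : 'I_(weight L i).-1 => \dim {:M (vmid j)} == n.+1).
  have /subvPn [u uj0 u_notin] : ~~ (limg (iota M (vmid j0)) <= limg (f i))%VS.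
    apply/negP => /dimvS; rewrite dim_iota dj0 dim_img ?f_inj //.
    by rewrite -/n ltnn.
  exists u; split=> // j dj.
  have -> : limg (iota M (vmid j)) = limg (iota M (vmid j0)).
    have [le_j|/ltnW le_j] := leqP j j0; apply/eqP.
      by rewrite eq_sym eqEdim arm_nested // !dim_iota dj dj0 /=.
    by rewrite eqEdim arm_nested // !dim_iota dj dj0 /=.
  apply/eqP; rewrite eq_sym eqEdim subv_add arm_sub -memvE uj0 dim_iota dj0.
  rewrite -[X in (X < _)%N](dim_img (f_inj i)) ltn_neqAle dimvS ?addvSl // andbT.
  rewrite (dimv_leqif_eq (addvSl _ _)) /= ?andbT; apply: contra u_notin => /eqP ->.
  by rewrite (subvP (addvSr _ _)) ?memv_line.
have /subvPn [u _ u_notin] : ~~ (fullv <= limg (f i))%VS.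
  by apply/negP => /dimvS; rewrite dimV dim_img ?f_inj // -/n addn2 ltnNge leqnSn.
by exists u; split=> // j dj; have := no_j j; rewrite dj eqxx.
Qed.

(** Via [iota] the spaces of an arm become subspaces of [V] and the arrows between them inclusions.
    Up to equality only three subspaces occur, and compatible bases of these suffice. *)
Theorem torsion_free_described : described_by_01m1 M.
Proof.
have [u uP] := fin_all_exists arm_line.
have uf i : u i \notin limg (f i) by have [] := uP i.
have [s [r [u' [s_basis r_basis fr us line]]]] :=
  adapted_bases free_f (@arm2E k L M) dimV uf.
(* The basis depends on the dimension alone: n gives f_i W, n + 1 adds the line of [u' i], and the
   remaining case n + 2 is all of [V]. *)
pose BS i d : seq V := if d == n then map (f i) r
  else if d == n.+1 then u' i :: map (f i) r else s.
have size_r : size r = n by rewrite /n (size_basis (X := in_tuple r) r_basis).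
have BS_mono i d d' z : (n <= d)%N -> (d <= d')%N -> (d' <= n + 2)%N ->
    z \in BS i d -> sign_comb (BS i d') z.
  have fs e : e \in map (f i) r -> sign_comb s e by case/mapP => e' /fr + ->; apply.
  rewrite /BS; case: (eqVneq d n) => [->|dn]; case: (eqVneq d' n) => [->|d'n].
  - by move=> *; apply: sign_comb_mem.
  - case: ifP => _ _ _ _ ze; last exact: fs.
    by apply: sign_comb_mem; rewrite inE ze orbT.
  - by lia.
  case: ifP => [/eqP ->|d1]; case: ifP => [/eqP d'1|d'1] le_n le_d le_n2 zB.
  - exact: sign_comb_mem.
  - by move: zB; rewrite inE => /predU1P [-> //|/fs].
  - by lia.
  exact: sign_comb_mem.
have fr_basis i : basis_of (limg (f i)) (map (f i) r).
  by apply: limg_basis_of => //; rewrite f_inj capv0.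
have dim_iota i (j : 'I_(weight L i).-1) :
    \dim (limg (iota M (vmid j))) = \dim {:M (vmid j)} by apply/dim_img/iota_inj.
have BS_basis i (j : 'I_(weight L i).-1) :
    basis_of (limg (iota M (vmid j))) (BS i (\dim {:M (vmid j)})).
  have /andP [le_n le_n2] := dim_inner j; rewrite /BS.
  case: eqP => [dn|dn].
    suff <- : limg (f i) = limg (iota M (vmid j)) by [].
    by apply/eqP; rewrite eqEdim arm_sub dim_iota dn dim_img ?f_inj /=.
  case: eqP => [dn1|dn1].
    rewrite basisEdim dim_iota dn1 /= size_map size_r leqnn andbT.
    have [_ ->] := uP i; last exact: dn1.
    by rewrite line span_cons addvC (span_basis (fr_basis i)).
  have dn2 : \dim {:M (vmid j)} = (n + 2)%N by lia.
  suff -> : limg (iota M (vmid j)) = fullv by [].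
  by apply/eqP; rewrite eqEdim subvf dim_iota dn2 dimV /=.
(* The bases of the images are pulled back along the injective [iota]. *)
pose B v : seq (M v) := match v with
  | vzero => s
  | vmid i j => map (iota M (vmid j))^-1%VF (BS i (\dim {:M (vmid j)}))
  | vc => r
  end.
have iotaB i (j : 'I_(weight L i).-1) :
    map (iota M (vmid j)) (B (vmid j)) = BS i (\dim {:M (vmid j)}).
  rewrite -map_comp -[RHS]map_id; apply/eq_in_map => z zB /=.
  by rewrite limg_lfunVK // (basis_mem (BS_basis i j)).
apply: (described_by_sign_comb (B := B)).
  case=> [|i j|] //=.
  rewrite basisEdim size_map -(size_basis (X := in_tuple _) (BS_basis i j)) dim_iota leqnn andbT.
  apply/subvP => z _; rewrite -limg_span (span_basis (BS_basis i j)).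
  rewrite -[z](lker0_lfunK (f := iota M (vmid j))) ?iota_inj //.
  by rewrite memv_img // memv_img ?memvf.
move=> v w a z; case: v w / a z => i j.
- move=> jE z zB; rewrite -iota_first; have /andP [le_n le_n2] := dim_inner j.
  have : iota M (vmid j) z \in BS i (\dim {:M (vmid j)}) by rewrite -iotaB map_f.
  move/(BS_mono _ _ (n + 2)%N); rewrite le_n le_n2 leqnn => /(_ isT isT isT).
  by rewrite /BS; case: eqP => [|_]; [lia | case: eqP => [|_ //]; lia].
- move=> j' jE z zB; apply: (sign_comb_map (@iota_inj _ _) (iotaB i j)) => //.
  rewrite -iota_mid; have /andP [le_n _] := dim_inner j'; have /andP [_ le_n2] := dim_inner j.
  apply: (BS_mono _ (\dim {:M (vmid j')})) => //; last by rewrite -iotaB map_f.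
  by rewrite -!dim_iota dimvS // arm_nested // jE leqnSn.
move=> jE z zB; apply: (sign_comb_map (@iota_inj _ _) (iotaB i j)) => //.
rewrite -iota_last; have /andP [le_n le_n2] := dim_inner j.
by apply: (BS_mono _ n) => //; rewrite /BS eqxx map_f.
Qed.

End TorsionFreeModules.

Theorem theorem1 (k : closedFieldType) (L : canonical_data k 3)
    (M : canonical_module L) :
  indecomposable M -> rank M = 2%:Z%R -> described_by_01m1 M.
Proof.
move=> indM rkM.
have [free_f iota_inj] := indecomposable_torsion_free indM (ltac:(by rewrite rkM)).
apply: torsion_free_described => //.
move: rkM; rewrite /rank => /eqP; rewrite subr_eq -PoszD => /eqP [->].
by rewrite addnC.
Qed.
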